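(* Every $2$-regular curve $\gamma: I\to\mathbb{E}^4$ admits a generalized Bishop frame of type C and a generalized Bishop frame of type D.
   Context: A regular curve $\gamma: I\to\mathbb{E}^4$ ($I$ an open interval) is considered with arc-length parametrization; $\mathbb{T}=\gamma'$ is its unit tangent vector. It is $2$-regular if $\mathbb{T}'$ is nowhere vanishing. A frame on $\gamma$ is an ordered orthonormal frame $(\mathbb{T},\mathbb{Z}_1,\mathbb{Z}_2,\mathbb{Z}_3)$ of smooth vector fields along $\gamma$ whose first vector is $\mathbb{T}$; it is identified with the smooth map $\mathbb{Z}: I\to O(4)$ whose rows are these vectors. Its coefficient matrix is the $\mathfrak{o}(4)$-valued function $X$ with $\mathbb{Z}'=X\mathbb{Z}$. A frame is of type C, resp. D, if, after possibly permuting $\mathbb{Z}_1,\mathbb{Z}_2,\mathbb{Z}_3$ (keeping $\mathbb{T}$ first), its coefficient matrix has the form, for some smooth functions $x_1,x_2,x_3$: Type C: $\begin{pmatrix}0&x_1&x_2&0\\-x_1&0&0&x_3\\-x_2&0&0&0\\0&-x_3&0&0\end{pmatrix}$; Type D: $\begin{pmatrix}0&x_1&0&0\\-x_1&0&x_2&x_3\\0&-x_2&0&0\\0&-x_3&0&0\end{pmatrix}$. *)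

(* Defs.v *)
From Stdlib Require Import Reals.
From Coquelicot Require Import Coquelicot.
Open Scope R_scope.

(* Vectors of E^4 are represented by their components, indexed by 0..3.
   A curve / vector field along a curve is a family  nat -> (R -> R)  of
   component functions (only indices < 4 matter). A frame is
   Z : nat -> nat -> R -> R, where  Z i j t  is the j-th component of the
   i-th vector of the frame at time t (i.e. the (i,j) entry of the matrix
   whose rows are the frame vectors).  Row 0 is T. *)

Definition in_I (a b : Rbar) (t : R) : Prop := Rbar_lt a t /\ Rbar_lt t b.

Definition smooth_on (a b : Rbar) (f : R -> R) : Prop :=
  forall (n : nat) (t : R), in_I a b t -> ex_derive_n f n t.

Definition sum4 (f : nat -> R) : R := sum_f_R0 f 3.

Definition tangent (gamma : nat -> R -> R) : nat -> R -> R :=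
  fun k t => Derive (gamma k) t.

Definition arclength_curve (a b : Rbar) (gamma : nat -> R -> R) : Prop :=
  (forall k, (k < 4)%nat -> smooth_on a b (gamma k)) /\
  (forall t, in_I a b t -> sum4 (fun k => (tangent gamma k t) ^ 2) = 1).

Definition two_regular (a b : Rbar) (gamma : nat -> R -> R) : Prop :=
  forall t, in_I a b t ->
    exists k, (k < 4)%nat /\ Derive (tangent gamma k) t <> 0.

Definition frame_on (a b : Rbar) (gamma : nat -> R -> R)
    (Z : nat -> nat -> R -> R) : Prop :=
  (forall i j, (i < 4)%nat -> (j < 4)%nat -> smooth_on a b (Z i j)) /\
  (forall j t, (j < 4)%nat -> in_I a b t -> Z 0%nat j t = tangent gamma j t) /\
  (forall i j t, (i < 4)%nat -> (j < 4)%nat -> in_I a b t ->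
     sum4 (fun k => Z i k t * Z j k t) = if Nat.eqb i j then 1 else 0).

Definition is_coef_matrix (a b : Rbar) (Z : nat -> nat -> R -> R)
    (X : nat -> nat -> R -> R) : Prop :=
  forall i j t, (i < 4)%nat -> (j < 4)%nat -> in_I a b t ->
    Derive (Z i j) t = sum4 (fun k => X i k t * Z k j t).

Definition perm_fix0 (s : nat -> nat) : Prop :=
  s 0%nat = 0%nat /\
  (forall i, (i < 4)%nat -> (s i < 4)%nat) /\
  (forall i j, (i < 4)%nat -> (j < 4)%nat -> s i = s j -> i = j).

Definition permute_frame (s : nat -> nat) (Z : nat -> nat -> R -> R) :
  nat -> nat -> R -> R := fun i j t => Z (s i) j t.

Definition matC (x1 x2 x3 : R -> R) : nat -> nat -> R -> R :=
  fun i j t =>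
    match i%nat, j%nat with
    | 0, 1 => x1 t | 0, 2 => x2 t
    | 1, 0 => - x1 t | 1, 3 => x3 t
    | 2, 0 => - x2 t
    | 3, 1 => - x3 t
    | _, _ => 0
    end.

Definition matD (x1 x2 x3 : R -> R) : nat -> nat -> R -> R :=
  fun i j t =>
    match i%nat, j%nat with
    | 0, 1 => x1 t
    | 1, 0 => - x1 t | 1, 2 => x2 t | 1, 3 => x3 t
    | 2, 1 => - x2 t
    | 3, 1 => - x3 t
    | _, _ => 0
    end.

Definition frame_of_type (M : (R -> R) -> (R -> R) -> (R -> R) -> nat -> nat -> R -> R)
    (a b : Rbar) (gamma : nat -> R -> R) (Z : nat -> nat -> R -> R) : Prop :=
  frame_on a b gamma Z /\
  exists (s : nat -> nat) (x1 x2 x3 : R -> R),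
    perm_fix0 s /\ smooth_on a b x1 /\ smooth_on a b x2 /\ smooth_on a b x3 /\
    is_coef_matrix a b (permute_frame s Z) (M x1 x2 x3).

Definition frame_type_C := frame_of_type matC.
Definition frame_type_D := frame_of_type matD.

(* Main.v *)
Require Import Defs.
From Stdlib Require Import Reals Lra Lia List Classical IndefiniteDescription.
From Coquelicot Require Import Coquelicot.
Open Scope R_scope.

(* For a unit field V along the curve, the linear equation Z' = -(Z.V')V has
   global solutions; those orthogonal to V at one point stay so, and their mutual
   inner products are constant.  Let N = T'/|T'|.

   Type D: T itself solves the equation for V = N.  Take a unit solution Z2
   orthogonal to T, and complete (T, N, Z2) by the cross product; then Z2', Z3'
   are multiples of N.

   Type C: let P1, P2, P3 be an orthonormal basis of the solutions for V = T.  The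
   direction of T' in the frame (P1, P2, P3) is a smooth curve in the projective
   plane, so it misses some direction; let Z2 be the constant combination of the
   Pi in that direction.  Then T, T', Z2 are everywhere independent, Z3 is their
   normalized cross product, and Z1 is orthogonal to T, Z2, Z3. *)

(** * Smooth functions on an open interval *)

(** In both types [Z2'] is a multiple of a single frame vector, which produces the zeros in its row;
    the other zeros only concern [T']. For type C they ask for a smooth unit [Z3] orthogonal to [T],
    [T'] and [Z2], and the danger is a time at which [T'] points along [Z2] or its opposite. The
    solutions for [V = T] have constant inner products, so a candidate for [Z2] is a fixed point of
    a projective plane in which the direction of [T'] moves. 2-regularity makes this moving
    direction defined at all times. Continuity alone would not let it miss a point, since a
    continuous curve can fill a square; smoothness makes it locally Lipschitz, and a counting
    argument then finds a free square inside every square. As the Lipschitz constants may blow up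
    towards the ends of the interval, compact pieces are treated one at a time and combined by
    nested squares. *)

Lemma in_I_locally (a b : Rbar) (t : R) :
  in_I a b t -> locally t (in_I a b).
Proof.
intros [Ha Hb].
apply filter_and; [exact (open_Rbar_gt a t Ha) | exact (open_Rbar_lt b t Hb)].
Qed.

Lemma in_I_between (a b : Rbar) (r s t : R) :
  in_I a b r -> in_I a b s -> r <= t <= s -> in_I a b t.
Proof.
intros [H1 _] [_ H2] [H3 H4]; split.
- apply Rbar_lt_le_trans with r; [exact H1 | exact H3].
- apply Rbar_le_lt_trans with s; [exact H4 | exact H2].
Qed.

Lemma Derive_ext_on (a b : Rbar) (f g : R -> R) (t : R) :
  (forall s, in_I a b s -> f s = g s) -> in_I a b t -> Derive f t = Derive g t.
Proof.
intros E Ht; apply Derive_ext_loc.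
now apply filter_imp with (2 := in_I_locally a b t Ht).
Qed.

(** [n]-fold differentiability on the interval. It peels derivatives off from the inside, whereas
    [Derive_n] adds them on the outside; closure properties thus become inductions on [n] using only
    first-order rules. *)
Fixpoint Ck (a b : Rbar) (n : nat) (f : R -> R) : Prop :=
  match n with
  | O => True
  | S n => (forall t, in_I a b t -> ex_derive f t) /\ Ck a b n (Derive f)
  end.

Lemma Derive_n_Derive (f : R -> R) (n : nat) (t : R) :
  Derive_n (Derive f) n t = Derive_n f (S n) t.
Proof.
change (Derive f) with (Derive_n f 1).
rewrite Derive_n_comp; now rewrite Nat.add_1_r.
Qed.

Lemma smooth_on_Ck (a b : Rbar) (f : R -> R) :
  smooth_on a b f <-> forall n, Ck a b n f.
Proof.
split.
- intros H n; revert f H; induction n as [|n IH]; intros f H; [exact Logic.I|].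
  split; [exact (H 1%nat)|].
  apply IH; intros k t Ht; destruct k as [|k]; [exact Logic.I|].
  apply ex_derive_ext with (Derive_n f (S k)).
  + intros s; now rewrite Derive_n_Derive.
  + exact (H (S (S k)) t Ht).
- intros H n t Ht.
  assert (Hn := H n); clear H; revert f Hn.
  induction n as [|n IH]; intros f H; [exact Logic.I|].
  destruct H as [H1 H2]; destruct n as [|n]; [exact (H1 t Ht)|].
  apply ex_derive_ext with (Derive_n (Derive f) n).
  + intros s; now rewrite Derive_n_Derive.
  + exact (IH _ H2).
Qed.

Lemma Ck_ext (a b : Rbar) (n : nat) (f g : R -> R) :
  (forall t, in_I a b t -> f t = g t) -> Ck a b n f -> Ck a b n g.
Proof.
revert f g; induction n as [|n IH]; intros f g E; [trivial|].
intros [H1 H2]; split.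
- intros t Ht; apply ex_derive_ext_loc with f; [|now apply H1].
  now apply filter_imp with (2 := in_I_locally a b t Ht).
- apply IH with (2 := H2); intros t Ht.
  now apply Derive_ext_on with (a := a) (b := b).
Qed.

Lemma Ck_le (a b : Rbar) (n : nat) (f : R -> R) : Ck a b (S n) f -> Ck a b n f.
Proof.
revert f; induction n as [|n IH]; intros f [H1 H2]; [exact Logic.I|].
split; [exact H1 | now apply IH].
Qed.

(** Replaces [Derive f] by an explicit formula, to which an induction hypothesis can be applied. *)
Lemma Ck_deriv (a b : Rbar) (n : nat) (f g : R -> R) :
  (forall t, in_I a b t -> is_derive f t (g t)) -> Ck a b n g -> Ck a b (S n) f.
Proof.
intros H Hg; split.
- intros t Ht; exists (g t); now apply H.
- apply Ck_ext with (2 := Hg); intros t Ht.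
  symmetry; now apply is_derive_unique, H.
Qed.

Lemma Ck_const (a b : Rbar) (n : nat) (c : R) : Ck a b n (fun _ => c).
Proof.
revert c; induction n as [|n IH]; intros c; [exact Logic.I|].
apply Ck_deriv with (fun _ => 0); [|apply IH].
intros t _; exact (is_derive_const c t).
Qed.

Lemma Ck_plus (a b : Rbar) (n : nat) (f g : R -> R) :
  Ck a b n f -> Ck a b n g -> Ck a b n (fun t => f t + g t).
Proof.
revert f g; induction n as [|n IH]; intros f g; [trivial|].
intros [F1 F2] [G1 G2].
apply Ck_deriv with (fun t => Derive f t + Derive g t).
- intros t Ht; apply (is_derive_plus f g); apply Derive_correct; auto.
- now apply IH.
Qed.

Lemma Ck_mult (a b : Rbar) (n : nat) (f g : R -> R) :
  Ck a b n f -> Ck a b n g -> Ck a b n (fun t => f t * g t).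
Proof.
revert f g; induction n as [|n IH]; intros f g; [trivial|].
intros F G.
assert (F0 := Ck_le _ _ _ _ F); assert (G0 := Ck_le _ _ _ _ G).
destruct F as [F1 F2]; destruct G as [G1 G2].
apply Ck_deriv with (fun t => Derive f t * g t + f t * Derive g t).
- intros t Ht; apply (is_derive_mult f g);
    [apply Derive_correct; auto..|exact Rmult_comm].
- now apply Ck_plus; apply IH.
Qed.

(** The derivative [- f' / f^2] contains [/ f] again, but one order lower, so the induction closes.
    The square root is treated likewise. *)
Lemma Ck_inv (a b : Rbar) (n : nat) (f : R -> R) :
  (forall t, in_I a b t -> f t <> 0) -> Ck a b n f -> Ck a b n (fun t => / f t).
Proof.
intros Hf; induction n as [|n IH]; [trivial|].
intros F; assert (F0 := Ck_le _ _ _ _ F); destruct F as [F1 F2].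
apply Ck_deriv with (fun t => (-1 * Derive f t) * (/ f t * / f t)).
- intros t Ht.
  replace (-1 * Derive f t * (/ f t * / f t)) with (- Derive f t / f t ^ 2)
    by (field; auto).
  apply is_derive_inv; [apply Derive_correct|]; auto.
- apply Ck_mult; apply Ck_mult; auto using Ck_const.
Qed.

Lemma Ck_sqrt (a b : Rbar) (n : nat) (f : R -> R) :
  (forall t, in_I a b t -> 0 < f t) -> Ck a b n f -> Ck a b n (fun t => sqrt (f t)).
Proof.
intros Hf; induction n as [|n IH]; [trivial|].
intros F; assert (F0 := Ck_le _ _ _ _ F); destruct F as [F1 F2].
assert (Hs : forall t, in_I a b t -> sqrt (f t) <> 0).
{ intros t Ht; apply Rgt_not_eq, sqrt_lt_R0; auto. }
apply Ck_deriv with (fun t => Derive f t * (/ 2 * / sqrt (f t))).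
- intros t Ht.
  replace (Derive f t * (/ 2 * / sqrt (f t))) with (Derive f t / (2 * sqrt (f t)))
    by (field; auto).
  apply is_derive_sqrt; [apply Derive_correct|]; auto.
- apply Ck_mult; [exact F2|]; apply Ck_mult; auto using Ck_const, Ck_inv.
Qed.

Lemma smooth_on_ext (a b : Rbar) (f g : R -> R) :
  (forall t, in_I a b t -> f t = g t) -> smooth_on a b f -> smooth_on a b g.
Proof. rewrite !smooth_on_Ck; eauto using Ck_ext. Qed.

Lemma smooth_on_const (a b : Rbar) (c : R) : smooth_on a b (fun _ => c).
Proof. rewrite smooth_on_Ck; auto using Ck_const. Qed.

Lemma smooth_on_plus (a b : Rbar) (f g : R -> R) :
  smooth_on a b f -> smooth_on a b g -> smooth_on a b (fun t => f t + g t).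
Proof. rewrite !smooth_on_Ck; auto using Ck_plus. Qed.

Lemma smooth_on_mult (a b : Rbar) (f g : R -> R) :
  smooth_on a b f -> smooth_on a b g -> smooth_on a b (fun t => f t * g t).
Proof. rewrite !smooth_on_Ck; auto using Ck_mult. Qed.

Lemma smooth_on_opp (a b : Rbar) (f : R -> R) :
  smooth_on a b f -> smooth_on a b (fun t => - f t).
Proof.
intros F; apply smooth_on_ext with (fun t => -1 * f t); [intros; ring|].
apply smooth_on_mult; auto using smooth_on_const.
Qed.

Lemma smooth_on_minus (a b : Rbar) (f g : R -> R) :
  smooth_on a b f -> smooth_on a b g -> smooth_on a b (fun t => f t - g t).
Proof. intros F G; apply smooth_on_plus; auto using smooth_on_opp. Qed.

Lemma smooth_on_inv_sqrt (a b : Rbar) (f : R -> R) :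
  (forall t, in_I a b t -> 0 < f t) -> smooth_on a b f ->
  smooth_on a b (fun t => / sqrt (f t)).
Proof.
intros Hf; rewrite !smooth_on_Ck; intros F n.
apply Ck_inv; [|now apply Ck_sqrt].
intros t Ht; apply Rgt_not_eq, sqrt_lt_R0; auto.
Qed.

Lemma smooth_on_Derive (a b : Rbar) (f : R -> R) : smooth_on a b f -> smooth_on a b (Derive f).
Proof. rewrite !smooth_on_Ck; intros F n; exact (proj2 (F (S n))). Qed.

Lemma smooth_on_ex_derive (a b : Rbar) (f : R -> R) (t : R) :
  smooth_on a b f -> in_I a b t -> ex_derive f t.
Proof. intros F; exact (F 1%nat t). Qed.

Lemma smooth_on_continuous (a b : Rbar) (f : R -> R) (t : R) :
  smooth_on a b f -> in_I a b t -> continuous f t.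
Proof. intros F Ht; apply (ex_derive_continuous f), (smooth_on_ex_derive a b); auto. Qed.

(** * Linear differential equations *)

Lemma forall_lt4 (P : nat -> Prop) :
  P 0%nat -> P 1%nat -> P 2%nat -> P 3%nat -> forall k, (k < 4)%nat -> P k.
Proof.
intros H0 H1 H2 H3 k Hk.
destruct k as [|[|[|[|k]]]]; auto; exfalso; lia.
Qed.

Lemma sum4_ext (f g : nat -> R) :
  (forall k, (k < 4)%nat -> f k = g k) -> sum4 f = sum4 g.
Proof.
intros E; unfold sum4; simpl; now rewrite !E by lia.
Qed.

Lemma sum4_minus (f g : nat -> R) : sum4 f - sum4 g = sum4 (fun k => f k - g k).
Proof. unfold sum4; simpl; ring. Qed.

Lemma sum4_Rabs_le (f : nat -> R) (M : R) :
  (forall k, (k < 4)%nat -> Rabs (f k) <= M) -> Rabs (sum4 f) <= 4 * M.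
Proof.
intros H; unfold sum4; simpl.
assert (H0 := H 0%nat ltac:(lia)); assert (H1 := H 1%nat ltac:(lia)).
assert (H2 := H 2%nat ltac:(lia)); assert (H3 := H 3%nat ltac:(lia)).
apply Rabs_le_between in H0, H1, H2, H3; apply Rabs_le; lra.
Qed.

Lemma is_derive_sum4 (f : nat -> R -> R) (df : nat -> R) (t : R) :
  (forall k, (k < 4)%nat -> is_derive (f k) t (df k)) ->
  is_derive (fun s => sum4 (fun k => f k s)) t (sum4 df).
Proof.
intros H; unfold sum4; simpl.
do 3 (apply (is_derive_plus (K := R_AbsRing) (V := R_NormedModule)); [|apply H; lia]);
  apply H; lia.
Qed.

Lemma smooth_on_sum4 (a b : Rbar) (f : nat -> R -> R) :
  (forall k, (k < 4)%nat -> smooth_on a b (f k)) ->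
  smooth_on a b (fun t => sum4 (fun k => f k t)).
Proof.
intros H; unfold sum4; simpl.
apply smooth_on_plus; [apply smooth_on_plus; [apply smooth_on_plus|]|]; apply H; lia.
Qed.

Lemma continuous_sum4 (f : nat -> R -> R) (t : R) :
  (forall k, (k < 4)%nat -> continuous (f k) t) ->
  continuous (fun s => sum4 (fun k => f k s)) t.
Proof.
intros H; unfold sum4; simpl.
do 3 (apply (continuous_plus (K := R_AbsRing) (V := R_NormedModule)); [|apply H; lia]);
  apply H; lia.
Qed.

Lemma is_lim_seq_sum4 (u : nat -> nat -> R) (l : nat -> R) :
  (forall k, (k < 4)%nat -> is_lim_seq (u k) (l k)) ->
  is_lim_seq (fun n => sum4 (fun k => u k n)) (sum4 l).
Proof.
intros H; unfold sum4; simpl.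
do 3 (apply is_lim_seq_plus'; [|apply H; lia]); apply H; lia.
Qed.

Lemma bounded_on_segment (f : R -> R) (r s : R) :
  r <= s -> (forall t, r <= t <= s -> continuous f t) ->
  exists K, forall t, r <= t <= s -> Rabs (f t) <= K.
Proof.
intros Hrs Hf.
destruct (continuity_ab_maj (fun t => Rabs (f t)) r s Hrs) as [m [Hm _]].
- intros t Ht; apply continuity_pt_filterlim.
  apply (continuous_comp f Rabs); [now apply Hf | apply continuous_Rabs].
- now exists (Rabs (f m)).
Qed.

Lemma bounded_family (f : nat -> R -> R) (n : nat) (P : R -> Prop) :
  (forall k, (k < n)%nat -> exists K, forall t, P t -> Rabs (f k t) <= K) ->
  exists K, forall k t, (k < n)%nat -> P t -> Rabs (f k t) <= K.
Proof.
induction n as [|n IH]; intros H.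
- exists 0; intros; lia.
- destruct IH as [K HK]; [intros k Hk; apply H; lia|].
  destruct (H n) as [K' HK']; [lia|].
  exists (Rmax K K'); intros k t Hk Ht.
  destruct (Nat.eq_dec k n) as [->|Hkn].
  + apply Rle_trans with (2 := Rmax_r K K'); auto.
  + apply Rle_trans with (2 := Rmax_l K K'); apply HK; [lia | auto].
Qed.

Lemma is_derive_RInt_on (a b : Rbar) (f : R -> R) (t0 t : R) :
  (forall s, in_I a b s -> continuous f s) -> in_I a b t0 -> in_I a b t ->
  is_derive (fun s => RInt f t0 s) t (f t).
Proof.
intros Hf H0 Ht; apply is_derive_RInt with t0; [|now apply Hf].
apply filter_imp with (2 := in_I_locally a b t Ht); intros s Hs.
apply RInt_correct, (ex_RInt_continuous (V := R_CompleteNormedModule)).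
intros z Hz; apply Hf; revert Hz; unfold Rmin, Rmax.
destruct (Rle_dec t0 s); intros Hz.
- now apply in_I_between with t0 s.
- now apply in_I_between with s t0.
Qed.

(** Both [g + f] and [g - f] are nondecreasing and vanish at [t0]. To the left of [t0] the function
    [g] is nonpositive, hence the absolute value on the right. *)
Lemma Rabs_le_of_deriv_le (f g df dg : R -> R) (r s t0 t : R) :
  (forall x, r <= x <= s ->
     is_derive f x (df x) /\ is_derive g x (dg x) /\ Rabs (df x) <= dg x) ->
  f t0 = 0 -> g t0 = 0 -> r <= t0 <= s -> r <= t <= s ->
  Rabs (f t) <= Rabs (g t).
Proof.
intros H Hf Hg H0 Ht.
assert (Hb : forall x, Rmin t0 t <= x <= Rmax t0 t -> r <= x <= s).
{ intros x; unfold Rmin, Rmax; destruct (Rle_dec t0 t); lra. }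
assert (Hmvt : forall e, Rabs e = 1 ->
  exists d, 0 <= d /\ g t + e * f t = d * (t - t0)).
{ intros e He.
  assert (Hd : forall x, r <= x <= s ->
    is_derive (fun y => g y + e * f y) x (dg x + e * df x)).
  { intros x Hx; destruct (H x Hx) as [H1 [H2 _]].
    apply (is_derive_plus g); [exact H2 | now apply (is_derive_scal f)]. }
  destruct (MVT_gen (fun y => g y + e * f y) t0 t (fun x => dg x + e * df x))
    as [x [Hx E]].
  - intros x Hx; apply Hd, Hb; lra.
  - intros x Hx; apply continuity_pt_filterlim.
    apply (ex_derive_continuous (fun y => g y + e * f y)).
    exists (dg x + e * df x); now apply Hd, Hb.
  - exists (dg x + e * df x); split.
    + destruct (H x (Hb x Hx)) as [_ [_ H3]].
      assert (Rabs (e * df x) <= dg x) by now rewrite Rabs_mult, He, Rmult_1_l.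
      apply Rabs_le_between in H1; lra.
    + rewrite Hf, Hg in E; lra. }
destruct (Hmvt 1) as [d1 [Hd1 E1]]; [apply Rabs_R1|].
destruct (Hmvt (-1)) as [d2 [Hd2 E2]]; [rewrite Rabs_left; lra|].
destruct (Rle_dec t0 t) as [L|L];
  [assert (0 <= d1 * (t - t0) /\ 0 <= d2 * (t - t0)) by (split; nra)
  |assert (d1 * (t - t0) <= 0 /\ d2 * (t - t0) <= 0) by (split; nra)];
  unfold Rabs; destruct (Rcase_abs (f t)), (Rcase_abs (g t)); lra.
Qed.

(** Iteration starts from zero instead of [c], so that the derivative formula with [pred n] holds
    even for [n = 0], where both sides vanish. *)
Fixpoint picard (A : nat -> nat -> R -> R) (c : nat -> R) (t0 : R) (n i : nat)
    (t : R) : R :=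
  match n with
  | O => 0
  | S n => c i + RInt (fun s => sum4 (fun j => A i j s * picard A c t0 n j s)) t0 t
  end.

Definition continuous_matrix (a b : Rbar) (A : nat -> nat -> R -> R) : Prop :=
  forall i j t, (i < 4)%nat -> (j < 4)%nat -> in_I a b t -> continuous (A i j) t.

Lemma is_derive_picard (a b : Rbar) (A : nat -> nat -> R -> R) (c : nat -> R)
    (t0 : R) (n i : nat) (t : R) :
  continuous_matrix a b A -> in_I a b t0 -> (i < 4)%nat -> in_I a b t ->
  is_derive (picard A c t0 n i) t
    (sum4 (fun j => A i j t * picard A c t0 (pred n) j t)).
Proof.
intros HA H0; revert i t; induction n as [|n IH]; intros i t Hi Ht; simpl.
- replace (sum4 _) with 0 by (unfold sum4; simpl; ring).
  apply (is_derive_const 0 t).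
- rewrite <- (Rplus_0_l (sum4 _)).
  apply (is_derive_plus (fun _ => c i)); [apply (is_derive_const (c i) t)|].
  apply (is_derive_RInt_on a b
    (fun s => sum4 (fun j => A i j s * picard A c t0 n j s))); auto.
  intros s Hs; apply (continuous_sum4 (fun j s => A i j s * picard A c t0 n j s)).
  intros j Hj; apply (continuous_mult (A i j)); [now apply HA|].
  apply (ex_derive_continuous (picard A c t0 n j)).
  eexists; now apply IH.
Qed.

Lemma Rabs_sinh_le (x : R) : Rabs (sinh x) <= cosh x.
Proof.
unfold sinh, cosh; assert (H1 := exp_pos x); assert (H2 := exp_pos (- x)).
apply Rabs_le; lra.
Qed.

Lemma cosh_ge1 (x : R) : 1 <= cosh x.
Proof.
unfold cosh; assert (E : exp x * exp (- x) = 1).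
{ rewrite <- exp_plus, Rplus_opp_r; apply exp_0. }
assert (H := exp_pos (- x)).
assert (0 <= exp (- x) * (exp x - 1) ^ 2) by (apply Rmult_le_pos; [lra | apply pow2_ge_0]).
replace (exp (- x) * (exp x - 1) ^ 2) with
  (exp x * exp (- x) * exp x - 2 * (exp x * exp (- x)) + exp (- x)) in H0 by ring.
rewrite E in H0; lra.
Qed.

Lemma exp_le_exp (x y : R) : x <= y -> exp x <= exp y.
Proof.
intros [H|H]; [left; now apply exp_increasing | right; now rewrite H].
Qed.

Lemma cosh_le (x y : R) : Rabs x <= y -> cosh x <= 2 * exp y.
Proof.
intros H; apply Rabs_le_between in H; unfold cosh.
assert (exp x <= exp y) by (apply exp_le_exp; lra).
assert (exp (- x) <= exp y) by (apply exp_le_exp; lra).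
assert (0 < exp y) by apply exp_pos; lra.
Qed.

(* Weighting by [cosh] turns the Picard iteration into a contraction of ratio
   1/2, whatever the length of the segment. *)
Lemma picard_step (a b : Rbar) (A : nat -> nat -> R -> R) (c : nat -> R)
    (t0 r s K C : R) (n i : nat) (t : R) :
  continuous_matrix a b A -> in_I a b r -> in_I a b s -> r <= t0 <= s ->
  (forall i j t, (i < 4)%nat -> (j < 4)%nat -> r <= t <= s -> Rabs (A i j t) <= K) ->
  (forall i, (i < 4)%nat -> Rabs (c i) <= C) ->
  (i < 4)%nat -> r <= t <= s ->
  Rabs (picard A c t0 (S n) i t - picard A c t0 n i t)
    <= C * (/ 2) ^ n * cosh (8 * K * (t - t0)).
Proof.
intros HA Hr Hs H0 HK HC.
assert (HI : forall x, r <= x <= s -> in_I a b x).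
{ intros x; now apply in_I_between. }
assert (C0 : 0 <= C).
{ apply Rle_trans with (2 := HC 0%nat ltac:(lia)), Rabs_pos. }
revert i t; induction n as [|n IH]; intros i t Hi Ht.
- simpl picard; rewrite (RInt_ext _ (fun _ => 0)), RInt_const.
  2: intros x _; unfold sum4; simpl; ring.
  replace (_ - _) with (c i) by (unfold scal; simpl; unfold mult; simpl; ring).
  assert (H1 := cosh_ge1 (8 * K * (t - t0))); assert (H2 := HC i Hi); simpl.
  nra.
(* The rate [8 * K] is chosen so that this [sinh] bound has derivative [4 * K] times the bound of
   stage [n]: one [K] for each of the four terms of the sum, with a factor 2 spent on the ratio. *)
- apply Rle_trans with (Rabs (C * (/ 2) ^ S n * sinh (8 * K * (t - t0)))).
  2: { assert (0 < (/ 2) ^ S n) by (apply pow_lt; lra).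
       rewrite Rabs_mult, (Rabs_pos_eq (_ * _)) by nra.
       apply Rmult_le_compat_l; [nra | apply Rabs_sinh_le]. }
  apply Rabs_le_of_deriv_le with
    (f := fun t => picard A c t0 (S (S n)) i t - picard A c t0 (S n) i t)
    (g := fun t => C * (/ 2) ^ S n * sinh (8 * K * (t - t0)))
    (df := fun t => sum4 (fun j =>
       A i j t * (picard A c t0 (S n) j t - picard A c t0 n j t)))
    (dg := fun t => 4 * (K * (C * (/ 2) ^ n * cosh (8 * K * (t - t0)))))
    (r := r) (s := s) (t0 := t0); auto.
  + intros x Hx; split; [|split].
    * replace (sum4 _) with
        (sum4 (fun j => A i j x * picard A c t0 (pred (S (S n))) j x)
         - sum4 (fun j => A i j x * picard A c t0 (pred (S n)) j x))
        by (rewrite sum4_minus; apply sum4_ext; intros; simpl pred; ring).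
      apply (is_derive_minus (picard A c t0 (S (S n)) i) (picard A c t0 (S n) i));
        apply is_derive_picard with a b; auto.
    * unfold sinh, cosh; auto_derive; [trivial|].
      unfold Rminus; simpl; field.
    * apply sum4_Rabs_le; intros j Hj; rewrite Rabs_mult.
      apply Rmult_le_compat; auto using Rabs_pos.
  + simpl picard; rewrite !RInt_point; unfold zero; simpl; ring.
  + unfold sinh; replace (8 * K * (t0 - t0)) with 0 by ring.
    rewrite Ropp_0, exp_0; lra.
Qed.

Lemma geometric_cauchy (u : nat -> R) (M : R) (N n : nat) :
  (forall n, Rabs (u (S n) - u n) <= M * (/ 2) ^ n) -> (N <= n)%nat ->
  Rabs (u n - u N) <= 2 * M * (/ 2) ^ N.
Proof.
intros H Hn.
assert (M0 : 0 <= M).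
{ assert (H1 := H 0%nat); assert (H2 := Rabs_pos (u 1%nat - u 0%nat)).
  simpl in H1; lra. }
(* The subtracted [(/ 2) ^ n] strengthens the claim enough for the telescoping induction. *)
assert (H1 : Rabs (u n - u N) <= 2 * M * ((/ 2) ^ N - (/ 2) ^ n)).
{ induction Hn as [|n Hn IH].
  - rewrite !Rminus_diag, Rabs_R0; lra.
  - replace (u (S n) - u N) with ((u (S n) - u n) + (u n - u N)) by ring.
    apply Rle_trans with (1 := Rabs_triang _ _).
    assert (H1 := H n); simpl; lra. }
assert (0 < (/ 2) ^ n) by (apply pow_lt; lra).
nra.
Qed.

Lemma picard_cauchy (a b : Rbar) (A : nat -> nat -> R -> R) (c : nat -> R)
    (t0 r s : R) :
  continuous_matrix a b A -> in_I a b r -> in_I a b s -> r <= t0 <= s ->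
  exists M, forall N n m i t, (i < 4)%nat -> r <= t <= s ->
    (N <= n)%nat -> (N <= m)%nat ->
    Rabs (picard A c t0 n i t - picard A c t0 m i t) <= M * (/ 2) ^ N.
Proof.
intros HA Hr Hs H0.
destruct (bounded_family (fun i _ => c i) 4 (fun _ => True)) as [C HC].
{ intros k _; exists (Rabs (c k)); intros; lra. }
assert (HK : exists K, forall i j t, (i < 4)%nat -> (j < 4)%nat -> r <= t <= s ->
  Rabs (A i j t) <= K).
(* The sixteen entries form one family, with entry [(i, j)] at index [j + i * 4]. *)
{ destruct (bounded_family (fun k => A (k / 4)%nat (k mod 4)%nat) 16
    (fun t => r <= t <= s)) as [K HK].
  - intros k Hk; apply bounded_on_segment; [lra|].
    intros t Ht; apply HA.
    + apply Nat.Div0.div_lt_upper_bound; lia.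
    + apply Nat.mod_upper_bound; lia.
    + now apply in_I_between with r s.
  - exists K; intros i j t Hi Hj Ht.
    specialize (HK (j + i * 4)%nat t ltac:(lia) Ht).
    rewrite Nat.div_add, Nat.Div0.mod_add, Nat.div_small, Nat.mod_small in HK by lia.
    exact HK. }
destruct HK as [K HK].
assert (C0 : 0 <= C).
{ apply Rle_trans with (2 := HC 0%nat 0 ltac:(lia) Logic.I), Rabs_pos. }
assert (K0 : 0 <= K).
{ apply Rle_trans with (2 := HK 0%nat 0%nat t0 ltac:(lia) ltac:(lia) H0), Rabs_pos. }
(* [cosh_le] contributes [2 * exp]; the 4 is twice the 2 of [geometric_cauchy], because both [n] and
   [m] are compared with [N]. *)
exists (4 * (C * (2 * exp (8 * K * (s - r))))); intros N n m i t Hi Ht Hn Hm.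
assert (Hstep : forall n, Rabs (picard A c t0 (S n) i t - picard A c t0 n i t)
  <= C * (2 * exp (8 * K * (s - r))) * (/ 2) ^ n).
{ intros k; eapply Rle_trans.
  - apply picard_step with (a := a) (b := b) (r := r) (s := s) (K := K) (C := C); auto.
  - rewrite (Rmult_assoc C (2 * exp _)), (Rmult_comm (2 * exp _)), <- Rmult_assoc.
    apply Rmult_le_compat_l; [apply Rmult_le_pos; [exact C0 | apply pow_le; lra]|].
    apply cosh_le; rewrite Rabs_mult, Rabs_pos_eq by lra.
    apply Rmult_le_compat_l; [lra|]; apply Rabs_le; lra. }
assert (H1 := geometric_cauchy _ _ _ _ Hstep Hn).
assert (H2 := geometric_cauchy _ _ _ _ Hstep Hm).
cbv beta in H1, H2.
apply Rabs_le_between in H1, H2; apply Rabs_le; lra.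
Qed.

Lemma half_pow_small (M eps : R) : 0 < eps -> exists N, M * (/ 2) ^ N < eps.
Proof.
intros He.
destruct (pow_lt_1_zero (/ 2)) with (y := eps / (Rabs M + 1)) as [N HN].
- rewrite Rabs_pos_eq; lra.
- apply Rdiv_lt_0_compat; [exact He|]; assert (H := Rabs_pos M); lra.
- exists N; specialize (HN N (Nat.le_refl N)).
  assert (H := Rabs_pos M); assert (H1 := Rle_abs M).
  assert (H2 : 0 < (/ 2) ^ N) by (apply pow_lt; lra).
  rewrite Rabs_pos_eq in HN by lra.
  apply Rlt_div_r in HN; [|lra]; nra.
Qed.

(** The closed segment carries the uniform bounds, and its interior is the open set on which limits
    are differentiated. *)
Lemma in_I_neighbourhood (a b : Rbar) (t0 t : R) :
  in_I a b t0 -> in_I a b t ->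
  exists r s, in_I a b r /\ in_I a b s /\ r < t0 < s /\ r < t < s.
Proof.
intros H0 Ht.
assert (Hmin : in_I a b (Rmin t0 t)) by (unfold Rmin; destruct Rle_dec; auto).
assert (Hmax : in_I a b (Rmax t0 t)) by (unfold Rmax; destruct Rle_dec; auto).
destruct (in_I_locally _ _ _ Hmin) as [e1 He1].
destruct (in_I_locally _ _ _ Hmax) as [e2 He2].
assert (P1 := cond_pos e1); assert (P2 := cond_pos e2).
exists (Rmin t0 t - e1 / 2), (Rmax t0 t + e2 / 2); repeat split.
1,2: apply He1. 3,4: apply He2.
1-4: unfold ball; simpl; unfold AbsRing_ball, abs, minus, plus, opp; simpl;
  apply Rabs_lt_between; lra.
all: assert (Q1 := Rmin_l t0 t); assert (Q2 := Rmin_r t0 t);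
  assert (Q3 := Rmax_l t0 t); assert (Q4 := Rmax_r t0 t); lra.
Qed.

(** On every segment the iterates and their derivatives are uniformly Cauchy, so the limit may be
    differentiated termwise. The ratio 1/2 is the same for all segments, which makes the solution
    global. *)
Lemma linear_ode (a b : Rbar) (A : nat -> nat -> R -> R) (c : nat -> R) (t0 : R) :
  continuous_matrix a b A -> in_I a b t0 ->
  exists Y : nat -> R -> R,
    (forall i, (i < 4)%nat -> Y i t0 = c i) /\
    (forall i t, (i < 4)%nat -> in_I a b t ->
       is_derive (Y i) t (sum4 (fun j => A i j t * Y j t))).
Proof.
intros HA H0.
assert (Hlim : forall i t, (i < 4)%nat -> in_I a b t ->
  is_lim_seq (fun n => picard A c t0 n i t)
    (real (Lim_seq (fun n => picard A c t0 n i t)))).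
{ intros i t Hi Ht; apply Lim_seq_correct', ex_lim_seq_cauchy_corr.
  intros eps; destruct (in_I_neighbourhood a b t0 t H0 Ht) as (r & s & Hr & Hs & H1 & H2).
  destruct (picard_cauchy a b A c t0 r s) as [M HM]; auto; [lra|].
  destruct (half_pow_small M eps (cond_pos eps)) as [N HN].
  exists N; intros n m Hn Hm; apply Rle_lt_trans with (2 := HN); apply HM; auto; lra. }
exists (fun i t => real (Lim_seq (fun n => picard A c t0 n i t))); split.
- intros i Hi.
  (* The iterate of index 0 is zero; from index 1 on, the value at [t0] is [c i]. *)
  rewrite <- Lim_seq_incr_1, (Lim_seq_ext _ (fun _ => c i)), Lim_seq_const; [easy|].
  intros n; simpl; rewrite RInt_point; unfold zero; simpl; ring.
- intros i t Hi Ht.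
  destruct (in_I_neighbourhood a b t0 t H0 Ht) as (r & s & Hr & Hs & H1 & H2).
  assert (HI : forall x, r < x < s -> in_I a b x).
  { intros x Hx; apply in_I_between with r s; auto; lra. }
  destruct (picard_cauchy a b A c t0 r s) as [M HM]; auto; [lra|].
  assert (HD : forall n x, r < x < s -> is_derive (picard A c t0 n i) x
    (sum4 (fun j => A i j x * picard A c t0 (pred n) j x))).
  { intros n x Hx; apply is_derive_picard with a b; auto. }
  replace (sum4 _) with (real (Lim_seq (fun n => Derive (picard A c t0 n i) t))).
  2: { rewrite (is_lim_seq_unique _ (sum4 (fun j =>
         A i j t * real (Lim_seq (fun n => picard A c t0 n j t))))); [easy|].
       apply is_lim_seq_ext with
         (fun n => sum4 (fun j => A i j t * picard A c t0 (pred n) j t)).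
       - intros n; symmetry; apply is_derive_unique, HD; lra.
       - apply (is_lim_seq_sum4 (fun j n => A i j t * picard A c t0 (pred n) j t)).
         intros j Hj; apply (is_lim_seq_scal_l _ (A i j t) (Finite _)).
         apply is_lim_seq_incr_1; simpl; now apply Hlim. }
  apply (CVU_Derive (fun n => picard A c t0 n i) (fun x => r < x < s)).
  + apply open_and; [apply open_gt | apply open_lt].
  + intros x y z; lra.
  + apply CVU_dom_cauchy; intros eps.
    destruct (half_pow_small M eps (cond_pos eps)) as [N HN].
    exists N; intros n m x Hx Hn Hm.
    apply Rle_lt_trans with (2 := HN); apply HM; auto; lra.
  + intros n x Hx; eexists; now apply HD.
  + intros n x Hx; apply continuity_pt_filterlim.
    apply continuous_ext_loc with
      (fun x => sum4 (fun j => A i j x * picard A c t0 (pred n) j x)).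
    * apply filter_imp with (fun x => r < x < s).
      -- intros y Hy; symmetry; apply is_derive_unique, HD, Hy.
      -- apply (open_and _ _ (open_gt r) (open_lt s)); exact Hx.
    * apply (continuous_sum4 (fun j x => A i j x * picard A c t0 (pred n) j x)).
      intros j Hj; apply (continuous_mult (A i j)); [now apply HA; auto|].
      apply (ex_derive_continuous (picard A c t0 (pred n) j)).
      eexists; apply is_derive_picard with a b; auto.
  + apply CVU_dom_cauchy; intros eps.
    destruct (bounded_family (fun j x => A i j x) 4 (fun x => r <= x <= s))
      as [K HK].
    { intros j Hj; apply bounded_on_segment; [lra|]; intros x Hx; apply HA; auto.
      now apply in_I_between with r s. }
    assert (K0 : 0 <= K).
    { apply Rle_trans with (2 := HK 0%nat t ltac:(lia) ltac:(lra)), Rabs_pos. }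
    destruct (half_pow_small (4 * (K * M)) eps (cond_pos eps)) as [N HN].
    (* The derivative of iterate [n] involves iterate [pred n], so the threshold rises by one. *)
    exists (S N); intros n m x Hx Hn Hm.
    apply Rle_lt_trans with (2 := HN).
    rewrite (is_derive_unique _ _ _ (HD n x Hx)), (is_derive_unique _ _ _ (HD m x Hx)).
    rewrite sum4_minus, Rmult_assoc, Rmult_assoc; apply sum4_Rabs_le.
    intros j Hj; rewrite <- Rmult_minus_distr_l, Rabs_mult.
    apply Rmult_le_compat; auto using Rabs_pos.
    * apply HK; auto; lra.
    * apply HM; auto; lia || lra.
  + lra.
Qed.

(** Bootstrap: if [Y] has [n] derivatives, so does the right-hand side, and [Y] gains one more. *)
Lemma smooth_on_linear_ode (a b : Rbar) (A : nat -> nat -> R -> R) (Y : nat -> R -> R) :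
  (forall i j, (i < 4)%nat -> (j < 4)%nat -> smooth_on a b (A i j)) ->
  (forall i t, (i < 4)%nat -> in_I a b t ->
     is_derive (Y i) t (sum4 (fun j => A i j t * Y j t))) ->
  forall i, (i < 4)%nat -> smooth_on a b (Y i).
Proof.
intros HA HY i Hi; rewrite smooth_on_Ck; intros n; revert i Hi.
induction n as [|n IH]; intros i Hi; [exact Logic.I|].
apply Ck_deriv with (fun t => sum4 (fun j => A i j t * Y j t)); [auto|].
assert (HA' : forall j, (j < 4)%nat -> Ck a b n (A i j)).
{ intros j Hj; now apply smooth_on_Ck, HA. }
unfold sum4; simpl.
apply Ck_plus; [apply Ck_plus; [apply Ck_plus|]|]; apply Ck_mult; auto with arith.
Qed.

(** * Directions missed by a smooth curve *)

Lemma pigeonhole (f : nat -> nat) (n : nat) :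
  (forall k, (k < S n)%nat -> (f k < n)%nat) ->
  exists k l, (k < S n)%nat /\ (l < S n)%nat /\ k <> l /\ f k = f l.
Proof.
intros Hf; apply NNPP; intros Hinj.
assert (Hnd : NoDup (map f (seq 0 (S n)))).
{ apply NoDup_map_NoDup_ForallPairs; [|apply seq_NoDup].
  intros k l Hk Hl E; apply in_seq in Hk, Hl.
  destruct (Nat.eq_dec k l) as [|Hkl]; [easy|].
  exfalso; apply Hinj; exists k, l; repeat split; auto; lia. }
apply NoDup_incl_length with (l' := seq 0 n) in Hnd.
- rewrite length_map, !length_seq in Hnd; lia.
- intros j Hj; apply in_map_iff in Hj; destruct Hj as [k [<- Hk]].
  apply in_seq in Hk; apply in_seq; specialize (Hf k); lia.
Qed.

Lemma nested_segments (l w : nat -> R) :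
  (forall n, 0 <= w n /\ l n <= l (S n) /\ l (S n) + w (S n) <= l n + w n) ->
  exists x, forall n, l n <= x <= l n + w n.
Proof.
intros H.
assert (Hle : forall n m, (n <= m)%nat -> l n <= l m /\ l m + w m <= l n + w n).
{ intros n m Hnm; induction Hnm as [|m Hnm IH]; [lra|].
  destruct (H m); lra. }
assert (Hub : forall n m, l n <= l m + w m).
{ intros n m; destruct (H n) as [H1 _], (H m) as [H2 _].
  destruct (Nat.le_ge_cases n m) as [L|L]; destruct (Hle _ _ L); lra. }
destruct (completeness (fun x => exists n, x = l n)) as [x [H1 H2]].
- exists (l 0%nat + w 0%nat); intros y [n ->]; apply Hub.
- now exists (l 0%nat), 0%nat.
- exists x; intros n; split.
  + apply H1; now exists n.
  + apply H2; intros y [m ->]; apply Hub.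
Qed.

(** Baire's argument: the squares are nested, condition [m] holds throughout square [m + 1], and a
    common point exists by completeness in each coordinate. *)
Lemma square_avoiding_sequence (P : nat -> R -> R -> Prop) :
  (forall m x0 y0 w0, 0 < w0 -> exists x1 y1 w1,
     (0 < w1 /\ x0 <= x1 /\ x1 + w1 <= x0 + w0 /\ y0 <= y1 /\ y1 + w1 <= y0 + w0) /\
     forall x y, x1 <= x <= x1 + w1 -> y1 <= y <= y1 + w1 -> P m x y) ->
  exists x y, 0 <= x <= 1 /\ 0 <= y <= 1 /\ forall m, P m x y.
Proof.
intros H.
destruct (functional_choice (fun (mq : nat * (R * R * R)) (q' : R * R * R) =>
  let '(m, (x0, y0, w0)) := mq in let '(x1, y1, w1) := q' in
  0 < w0 ->
  (0 < w1 /\ x0 <= x1 /\ x1 + w1 <= x0 + w0 /\ y0 <= y1 /\ y1 + w1 <= y0 + w0) /\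
  forall x y, x1 <= x <= x1 + w1 -> y1 <= y <= y1 + w1 -> P m x y)) as [f Hf].
{ intros [m [[x0 y0] w0]].
  (* The choice function must be total, so a degenerate square gets a dummy value. *)
  destruct (Rlt_dec 0 w0) as [Hw|Hw].
  - destruct (H m x0 y0 w0 Hw) as (x1 & y1 & w1 & H1); now exists (x1, y1, w1).
  - exists (0, 0, 0); intros; contradiction. }
set (q := nat_rect (fun _ => (R * R * R)%type) (0, 0, 1) (fun m q => f (m, q))).
set (X := fun n => fst (fst (q n))); set (Y := fun n => snd (fst (q n))).
set (W := fun n => snd (q n)).
assert (Hstep : forall n, 0 < W n -> (0 < W (S n) /\ X n <= X (S n) /\
    X (S n) + W (S n) <= X n + W n /\ Y n <= Y (S n) /\
    Y (S n) + W (S n) <= Y n + W n) /\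
  forall x y, X (S n) <= x <= X (S n) + W (S n) ->
    Y (S n) <= y <= Y (S n) + W (S n) -> P n x y).
{ intros n; unfold X, Y, W; simpl.
  specialize (Hf (n, q n)); destruct (q n) as [[x0 y0] w0].
  destruct (f (n, (x0, y0, w0))) as [[x1 y1] w1]; exact Hf. }
assert (HW : forall n, 0 < W n).
{ induction n as [|n IH]; [exact Rlt_0_1 | now apply Hstep]. }
destruct (nested_segments X W) as [x Hx].
{ intros n; destruct (Hstep n (HW n)) as [H1 _]; assert (H2 := HW n); lra. }
destruct (nested_segments Y W) as [y Hy].
{ intros n; destruct (Hstep n (HW n)) as [H1 _]; assert (H2 := HW n); lra. }
exists x, y; split; [|split].
- specialize (Hx 0%nat); unfold X, W in Hx; simpl in Hx; lra.
- specialize (Hy 0%nat); unfold Y, W in Hy; simpl in Hy; lra.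
- intros m; now apply (Hstep m (HW m)).
Qed.

(* A Lipschitz curve meets at most O(M) of M^2 separated squares of side O(1/M). *)
Lemma lipschitz_curve_misses_square (B : R -> R -> R -> Prop) (r s Lam : R) :
  r <= s -> 0 < Lam ->
  (forall t t' x y x' y', r <= t <= s -> r <= t' <= s -> B t x y -> B t' x' y' ->
     Rabs (x - x') <= Lam * Rabs (t - t') /\ Rabs (y - y') <= Lam * Rabs (t - t')) ->
  forall x0 y0 w0, 0 < w0 -> exists x1 y1 w1,
    (0 < w1 /\ x0 <= x1 /\ x1 + w1 <= x0 + w0 /\ y0 <= y1 /\ y1 + w1 <= y0 + w0) /\
    forall x y, x1 <= x <= x1 + w1 -> y1 <= y <= y1 + w1 ->
      forall t, r <= t <= s -> ~ B t x y.
Proof.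
intros Hrs HLam HB x0 y0 w0 Hw0.
(* A coordinate needs time [h / Lam] to change by [h]. With [h = w0 / (2 * INR M)] the segment
   contains [G * INR M] such spans, and [G + 1 < INR M] makes this less than [M * M - 1]. *)
set (G := (s - r) * (2 * Lam) / w0).
assert (G0 : 0 <= G).
{ apply Rmult_le_pos; [nra | left; now apply Rinv_0_lt_compat]. }
destruct (nfloor_ex G G0) as [M0 [_ HM0]].
set (M := S (S M0)).
assert (HM : G + 1 < INR M) by (unfold M; rewrite !S_INR; lra).
assert (HMM : (1 <= M * M)%nat) by (unfold M; lia).
(* The factor 2 leaves gaps of width [h] between cells of side [h]: points of distinct cells differ
   by at least [h] in some coordinate. *)
set (h := w0 / (2 * INR M)).
assert (h0 : 0 < h) by (apply Rdiv_lt_0_compat; lra).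
assert (Hh : 2 * INR M * h = w0) by (unfold h; field; lra).
assert (Hcell : forall z0 i, (i < M)%nat ->
  z0 <= z0 + 2 * INR i * h /\ z0 + 2 * INR i * h + h <= z0 + w0).
{ intros z0 i Hi; assert (H1 := pos_INR i).
  assert (H2 : INR i + 1 <= INR M) by (rewrite <- S_INR; apply le_INR; lia).
  split; nra. }
apply NNPP; intros Hno.
assert (Hbad : forall k, exists t, (k < M * M)%nat -> r <= t <= s /\ exists x y,
  x0 + 2 * INR (k mod M) * h <= x <= x0 + 2 * INR (k mod M) * h + h /\
  y0 + 2 * INR (k / M) * h <= y <= y0 + 2 * INR (k / M) * h + h /\ B t x y).
{ intros k; apply NNPP; intros Hk; apply Hno.
  assert (kM : (k < M * M)%nat).
  { apply NNPP; intros L; apply Hk; exists 0; intros; contradiction. }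
  exists (x0 + 2 * INR (k mod M) * h), (y0 + 2 * INR (k / M) * h), h.
  destruct (Hcell x0 (k mod M)) as [C1 C2]; [apply Nat.mod_upper_bound; lia|].
  destruct (Hcell y0 (k / M)%nat) as [C3 C4];
    [apply Nat.Div0.div_lt_upper_bound; lia|].
  split; [lra|].
  intros x y Hx Hy t Ht HBt; apply Hk; exists t; intros _.
  split; [exact Ht|]; now exists x, y. }
apply functional_choice in Hbad; destruct Hbad as [tf Htf].
assert (Hbin : forall k, exists n, (k < M * M)%nat ->
  INR n <= (tf k - r) * (Lam / h) < INR n + 1).
{ intros k; destruct (classic (k < M * M)%nat) as [L|L].
  - destruct (Htf k L) as [H1 _].
    destruct (nfloor_ex ((tf k - r) * (Lam / h))) as [n Hn].
    + apply Rmult_le_pos; [lra | left; now apply Rdiv_lt_0_compat].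
    + now exists n.
  - exists 0%nat; intros; contradiction. }
apply functional_choice in Hbin; destruct Hbin as [bin Hbin].
(* If every cell is met, two distinct cells are met within the same time bin, hence less than
   [h / Lam] apart, too short for crossing a gap. *)
destruct (pigeonhole bin (M * M - 1)) as (k & l & Hk & Hl & Hkl & E).
{ intros k Hk; assert (L : (k < M * M)%nat) by lia.
  destruct (Htf k L) as [H1 _]; destruct (Hbin k L) as [H2 _].
  apply INR_lt; rewrite minus_INR, mult_INR by exact HMM; simpl (INR 1).
  apply Rle_lt_trans with (1 := H2).
  apply Rle_lt_trans with (G * INR M).
  - replace (G * INR M) with ((s - r) * (Lam / h))
      by (unfold G, h; field; repeat split; lra).
    apply Rmult_le_compat_r; [left; now apply Rdiv_lt_0_compat | lra].
  - nra. }
replace (S (M * M - 1)) with (M * M)%nat in Hk, Hl by lia.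
destruct (Htf k Hk) as [Tk (x & y & Hx & Hy & Bk)].
destruct (Htf l Hl) as [Tl (x' & y' & Hx' & Hy' & Bl)].
destruct (HB _ _ _ _ _ _ Tk Tl Bk Bl) as [D1 D2].
assert (Hsep : forall i j z z' c, i <> j ->
  c + 2 * INR i * h <= z <= c + 2 * INR i * h + h ->
  c + 2 * INR j * h <= z' <= c + 2 * INR j * h + h -> h <= Rabs (z - z')).
{ intros i j z z' c Hij Hz Hz'.
  destruct (Nat.lt_total i j) as [L|[L|L]]; [|contradiction|];
    apply le_INR in L; rewrite S_INR in L.
  - rewrite Rabs_minus_sym; apply Rle_trans with (2 := Rle_abs _); nra.
  - apply Rle_trans with (2 := Rle_abs _); nra. }
assert (Hfar : h <= Lam * Rabs (tf k - tf l)).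
{ destruct (Nat.eq_dec (k mod M) (l mod M)) as [E1|E1];
    [destruct (Nat.eq_dec (k / M) (l / M)) as [E2|E2]|].
  - exfalso; apply Hkl; rewrite (Nat.div_mod_eq k M), (Nat.div_mod_eq l M); congruence.
  - apply Rle_trans with (2 := D2); now apply Hsep with (c := y0) (1 := E2).
  - apply Rle_trans with (2 := D1); now apply Hsep with (c := x0) (1 := E1). }
assert (Hnear : Rabs ((tf k - r) * (Lam / h) - (tf l - r) * (Lam / h)) < 1).
{ assert (H1 := Hbin k Hk); assert (H2 := Hbin l Hl); rewrite E in H1.
  apply Rabs_lt_between; lra. }
replace (_ - _) with ((tf k - tf l) * (Lam / h)) in Hnear by ring.
rewrite Rabs_mult, (Rabs_pos_eq (Lam / h)) in Hnear
  by (left; now apply Rdiv_lt_0_compat).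
apply (Rmult_lt_compat_r h) in Hnear; [|exact h0].
replace (Rabs (tf k - tf l) * (Lam / h) * h) with (Lam * Rabs (tf k - tf l))
  in Hnear by (field; lra).
lra.
Qed.

(** The conclusion holds for all later indices, so that [exhaustion] can take the larger of the
    indices found for the two ends. *)
Lemma exhaustion_right (a b : Rbar) (t0 : R) :
  in_I a b t0 -> exists u : nat -> R,
    (forall m, in_I a b (u m) /\ t0 <= u m) /\
    forall t, in_I a b t -> exists m, forall n, (m <= n)%nat -> t <= u n.
Proof.
intros [Ha Hb]; destruct b as [b| |]; simpl in Hb; [| |contradiction].
- assert (Hm : forall m, 0 < / (INR m + 1) <= 1).
  { intros m; assert (H := pos_INR m); split; [apply Rinv_0_lt_compat; lra|].
    rewrite <- Rinv_1; apply Rinv_le_contravar; lra. }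
  exists (fun m => b - (b - t0) * / (INR m + 1)); split.
  + intros m; specialize (Hm m).
    assert (L : t0 <= b - (b - t0) * / (INR m + 1)) by nra.
    split; [split|exact L].
    * apply Rbar_lt_le_trans with t0; [exact Ha | exact L].
    * simpl; nra.
  + intros t [_ Ht]; simpl in Ht.
    destruct (archimed_cor1 ((b - t) / (b - t0))) as [m [H1 H2]].
    { apply Rdiv_lt_0_compat; lra. }
    exists m; intros n Hn; assert (H3 : / (INR n + 1) <= / INR m).
    { apply Rinv_le_contravar; [now apply lt_0_INR | apply le_INR in Hn; lra]. }
    assert (H4 : (b - t0) * / (INR n + 1) <= (b - t0) * ((b - t) / (b - t0))).
    { apply Rmult_le_compat_l; lra. }
    replace ((b - t0) * ((b - t) / (b - t0))) with (b - t) in H4 by (field; lra).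
    lra.
- exists (fun m => t0 + INR m); split.
  + intros m; assert (H := pos_INR m); split; [|lra].
    split; [|exact Logic.I].
    apply Rbar_lt_le_trans with t0; [exact Ha | simpl; lra].
  + intros t _; destruct (nfloor_ex (Rmax 0 (t - t0))) as [m Hm]; [apply Rmax_l|].
    exists (S m); intros n Hn; apply le_INR in Hn; rewrite S_INR in Hn.
    assert (H := Rmax_r 0 (t - t0)); lra.
Qed.

Lemma in_I_opp (a b : Rbar) (t : R) :
  in_I a b t -> in_I (Rbar_opp b) (Rbar_opp a) (- t).
Proof.
intros [H1 H2].
split; [exact (proj2 (Rbar_opp_lt b t) H2) | exact (proj2 (Rbar_opp_lt t a) H1)].
Qed.

(** The left end comes from [exhaustion_right] through the reflection of [t] into [- t]. *)
Lemma exhaustion (a b : Rbar) (t0 : R) :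
  in_I a b t0 -> exists u v : nat -> R,
    (forall m, in_I a b (u m) /\ in_I a b (v m) /\ u m <= t0 <= v m) /\
    forall t, in_I a b t -> exists m, u m <= t <= v m.
Proof.
intros H0.
destruct (exhaustion_right _ _ _ H0) as [v [Hv1 Hv2]].
destruct (exhaustion_right _ _ _ (in_I_opp _ _ _ H0)) as [u [Hu1 Hu2]].
assert (Hu3 : forall m, in_I a b (- u m) /\ - u m <= t0).
{ intros m; destruct (Hu1 m) as [H1 H2]; apply in_I_opp in H1.
  rewrite !Rbar_opp_involutive in H1; split; [exact H1 | lra]. }
exists (fun m => - u m), v; split.
- intros m; destruct (Hv1 m), (Hu3 m); auto.
- intros t Ht; destruct (Hv2 t Ht) as [m Hm].
  destruct (Hu2 (- t) (in_I_opp _ _ _ Ht)) as [n Hn].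
  exists (Nat.max m n).
  specialize (Hm _ (Nat.le_max_l m n)); specialize (Hn _ (Nat.le_max_r m n)); lra.
Qed.

Lemma lipschitz_on_segment (a b : Rbar) (f : R -> R) (r s : R) :
  smooth_on a b f -> in_I a b r -> in_I a b s -> r <= s ->
  exists C, forall t t', r <= t <= s -> r <= t' <= s ->
    Rabs (f t - f t') <= C * Rabs (t - t').
Proof.
intros Hf Hr Hs Hrs.
assert (HI : forall x, r <= x <= s -> in_I a b x).
{ intros x; now apply in_I_between. }
destruct (bounded_on_segment (Derive f) r s Hrs) as [C HC].
{ intros t Ht; apply (smooth_on_continuous a b); auto using smooth_on_Derive. }
exists C; intros t t' Ht Ht'.
assert (Hb : forall x, Rmin t' t <= x <= Rmax t' t -> r <= x <= s).
{ intros x; unfold Rmin, Rmax; destruct (Rle_dec t' t); lra. }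
destruct (MVT_gen f t' t (Derive f)) as [x [Hx E]].
- intros x Hx; apply Derive_correct, (smooth_on_ex_derive a b); auto.
  apply HI, Hb; lra.
- intros x Hx; apply continuity_pt_filterlim, (smooth_on_continuous a b); auto.
- rewrite E, Rabs_mult; apply Rmult_le_compat_r; [apply Rabs_pos | auto].
Qed.

(* The missed direction [(x : y : 1)] is found by a Baire argument over a compact
   exhaustion of the interval. *)
Lemma smooth_curve_misses_direction (a b : Rbar) (n1 n2 n3 : R -> R) :
  smooth_on a b n1 -> smooth_on a b n2 -> smooth_on a b n3 ->
  (forall t, in_I a b t -> 0 < n1 t ^ 2 + n2 t ^ 2 + n3 t ^ 2) ->
  exists x y, forall t, in_I a b t -> ~ (n1 t = x * n3 t /\ n2 t = y * n3 t).
Proof.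
intros S1 S2 S3 Hn.
destruct (classic (exists t0, in_I a b t0)) as [[t0 H0]|Hempty].
2: { exists 0, 0; intros t Ht; exfalso; apply Hempty; now exists t. }
destruct (exhaustion _ _ _ H0) as (u & v & Huv & Hex).
(* Restricting to the unit square keeps the curve away from the line at infinity: there
   [n1^2 + n2^2 <= 2 * n3^2], so [n3] is bounded away from zero and the affine coordinates are
   Lipschitz. *)
destruct (square_avoiding_sequence (fun m x y => forall t, u m <= t <= v m ->
  ~ ((0 <= x <= 1 /\ 0 <= y <= 1) /\ n1 t = x * n3 t /\ n2 t = y * n3 t)))
  as (x & y & Hx & Hy & H).
2: { exists x, y; intros t Ht E; destruct (Hex t Ht) as [m Hm].
     now apply (H m t Hm). }
intros m; destruct (Huv m) as (Hu & Hv & L).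
assert (Luv : u m <= v m) by lra.
destruct (lipschitz_on_segment a b n1 _ _ S1 Hu Hv Luv) as [C1 HC1].
destruct (lipschitz_on_segment a b n2 _ _ S2 Hu Hv Luv) as [C2 HC2].
destruct (lipschitz_on_segment a b n3 _ _ S3 Hu Hv Luv) as [C3 HC3].
assert (HI : forall t, u m <= t <= v m -> in_I a b t).
{ intros t; now apply in_I_between. }
destruct (bounded_on_segment n3 _ _ Luv) as [K HK].
{ intros t Ht; apply (smooth_on_continuous a b); auto. }
destruct (bounded_on_segment (fun t => / (n1 t ^ 2 + n2 t ^ 2 + n3 t ^ 2)) _ _ Luv)
  as [Q HQ].
{ intros t Ht.
  assert (Hd : forall f, smooth_on a b f -> ex_derive f t).
  { intros f F; apply (smooth_on_ex_derive a b); auto. }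
  apply (ex_derive_continuous (fun t => / (n1 t ^ 2 + n2 t ^ 2 + n3 t ^ 2))).
  auto_derive; repeat split; auto.
  apply Rgt_not_eq; simpl; specialize (Hn t (HI t Ht)); simpl in Hn; exact Hn. }
set (C := Rmax (Rmax C1 C2) (Rmax C3 0)).
assert (HC : C1 <= C /\ C2 <= C /\ C3 <= C /\ 0 <= C).
{ unfold C; assert (H1 := Rmax_l C1 C2); assert (H2 := Rmax_r C1 C2).
  assert (H3 := Rmax_l C3 0); assert (H4 := Rmax_r C3 0).
  assert (H5 := Rmax_l (Rmax C1 C2) (Rmax C3 0)).
  assert (H6 := Rmax_r (Rmax C1 C2) (Rmax C3 0)); lra. }
assert (K0 : 0 <= K).
{ apply Rle_trans with (2 := HK t0 L), Rabs_pos. }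
assert (Q0 : 0 <= Q).
{ apply Rle_trans with (2 := HQ t0 L), Rabs_pos. }
(* Lipschitz bound for the quotient [z = p / n3]: [(z - z') * n3 t] is at most
   [2 * C * Rabs (t - t')] in absolute value, and [1 <= 3 * Q * n3^2] trades the factor [n3 t] for
   [3 * Q * K]. The added 1 makes the constant positive. *)
assert (Hquot : forall p t t' z z', u m <= t <= v m -> u m <= t' <= v m ->
  (forall t t', u m <= t <= v m -> u m <= t' <= v m ->
     Rabs (p t - p t') <= C * Rabs (t - t')) ->
  0 <= z' <= 1 -> p t = z * n3 t -> p t' = z' * n3 t' ->
  n1 t ^ 2 + n2 t ^ 2 + n3 t ^ 2 <= 3 * n3 t ^ 2 ->
  Rabs (z - z') <= (6 * Q * K * C + 1) * Rabs (t - t')).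
{ intros p t t' z z' Ht Ht' Hp Hz E E' H3.
  assert (D0 := Rabs_pos (t - t')).
  assert (B1 : Rabs (z - z') * Rabs (n3 t) <= 2 * C * Rabs (t - t')).
  { rewrite <- Rabs_mult.
    replace ((z - z') * n3 t) with ((p t - p t') - z' * (n3 t - n3 t'))
      by (rewrite E, E'; ring).
    apply Rle_trans with (1 := Rabs_triang _ _); rewrite Rabs_Ropp, Rabs_mult.
    rewrite (Rabs_pos_eq z') by lra.
    assert (B2 := Hp t t' Ht Ht'); assert (B3 := HC3 t t' Ht Ht').
    assert (B4 := Rabs_pos (n3 t - n3 t')); nra. }
  assert (B5 : 1 <= 3 * Q * (Rabs (n3 t) * Rabs (n3 t))).
  { assert (B6 := HQ t Ht); assert (B7 := Hn t (HI t Ht)).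
    rewrite Rabs_pos_eq in B6 by (left; now apply Rinv_0_lt_compat).
    rewrite <- Rabs_mult, Rabs_pos_eq by nra.
    apply (Rmult_le_compat_r (n1 t ^ 2 + n2 t ^ 2 + n3 t ^ 2)) in B6; [|lra].
    rewrite Rinv_l in B6 by lra; nra. }
  assert (B8 := HK t Ht); assert (B9 := Rabs_pos (n3 t)).
  assert (B10 := Rabs_pos (z - z')).
  apply Rle_trans with (Rabs (z - z') * (3 * Q * (Rabs (n3 t) * Rabs (n3 t))));
    [nra|].
  replace (Rabs (z - z') * (3 * Q * (Rabs (n3 t) * Rabs (n3 t)))) with
    (3 * Q * (Rabs (z - z') * Rabs (n3 t)) * Rabs (n3 t)) by ring.
  apply Rle_trans with (3 * Q * (2 * C * Rabs (t - t')) * K); [|nra].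
  apply Rmult_le_compat; auto.
  - apply Rmult_le_pos; [lra | apply Rmult_le_pos; auto].
  - apply Rmult_le_compat_l; [lra | exact B1]. }
apply lipschitz_curve_misses_square with (Lam := 6 * Q * K * C + 1); [exact Luv| |].
- assert (0 <= 6 * Q * K * C) by (repeat apply Rmult_le_pos; lra); lra.
- intros t t' x y x' y' Ht Ht' ((Hx & Hy) & E1 & E2) ((Hx' & Hy') & E1' & E2').
  assert (H3 : n1 t ^ 2 + n2 t ^ 2 + n3 t ^ 2 <= 3 * n3 t ^ 2).
  { rewrite E1, E2.
    assert (Hxx : x ^ 2 <= 1) by nra; assert (Hyy : y ^ 2 <= 1) by nra.
    assert (Hnn := pow2_ge_0 (n3 t)); nra. }
  split; [apply (Hquot n1) | apply (Hquot n2)]; auto; intros s s' Hs Hs'.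
  + apply Rle_trans with (1 := HC1 s s' Hs Hs').
    apply Rmult_le_compat_r; [apply Rabs_pos | lra].
  + apply Rle_trans with (1 := HC2 s s' Hs Hs').
    apply Rmult_le_compat_r; [apply Rabs_pos | lra].
Qed.

(** * Frames in four-space *)

Definition vsmooth (a b : Rbar) (U : nat -> R -> R) : Prop :=
  forall k, (k < 4)%nat -> smooth_on a b (U k).

Definition dot (U V : nat -> R -> R) (t : R) : R := sum4 (fun k => U k t * V k t).

Lemma dot_comm (U V : nat -> R -> R) (t : R) : dot U V t = dot V U t.
Proof. apply sum4_ext; intros; ring. Qed.

Lemma dot_scal_l (U V W : nat -> R -> R) (c t : R) :
  (forall k, (k < 4)%nat -> U k t = c * V k t) -> dot U W t = c * dot V W t.
Proof.
intros H; unfold dot, sum4; simpl; rewrite !H by lia; ring.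
Qed.

Lemma smooth_on_dot (a b : Rbar) (U V : nat -> R -> R) :
  vsmooth a b U -> vsmooth a b V -> smooth_on a b (dot U V).
Proof.
intros HU HV; apply (smooth_on_sum4 a b (fun k t => U k t * V k t)).
intros k Hk; apply smooth_on_mult; auto.
Qed.

Lemma vsmooth_tangent (a b : Rbar) (U : nat -> R -> R) :
  vsmooth a b U -> vsmooth a b (tangent U).
Proof. intros H k Hk; apply smooth_on_Derive, H, Hk. Qed.

Lemma is_derive_dot (a b : Rbar) (U V : nat -> R -> R) (t : R) :
  vsmooth a b U -> vsmooth a b V -> in_I a b t ->
  is_derive (dot U V) t (dot (tangent U) V t + dot U (tangent V) t).
Proof.
intros HU HV Ht.
replace (_ + _) with
  (sum4 (fun k => tangent U k t * V k t + U k t * tangent V k t))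
  by (unfold dot, sum4; simpl; ring).
apply (is_derive_sum4 (fun k t => U k t * V k t)); intros k Hk.
apply (is_derive_mult (U k) (V k)); [| |exact Rmult_comm];
  apply Derive_correct, (smooth_on_ex_derive a b); auto.
Qed.

Lemma dot_const_deriv (a b : Rbar) (U V : nat -> R -> R) (c t : R) :
  vsmooth a b U -> vsmooth a b V -> (forall s, in_I a b s -> dot U V s = c) ->
  in_I a b t -> dot (tangent U) V t = - dot U (tangent V) t.
Proof.
intros HU HV Hc Ht.
assert (E := is_derive_unique _ _ _ (is_derive_dot a b U V t HU HV Ht)).
rewrite (Derive_ext_on a b _ (fun _ => c)), Derive_const in E; auto.
lra.
Qed.

Lemma constant_on_I (a b : Rbar) (f : R -> R) (s t : R) :
  (forall r, in_I a b r -> is_derive f r 0) -> in_I a b s -> in_I a b t -> f s = f t.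
Proof.
intros H Hs Ht; destruct (Rtotal_order s t) as [L|[->|L]]; [|reflexivity|symmetry];
  apply (eq_is_derive f); auto; intros r Hr; apply H.
- now apply in_I_between with s t.
- now apply in_I_between with t s.
Qed.

(* Parallel transport in the normal bundle of a unit field [V]. *)
Definition parallel (a b : Rbar) (V Z : nat -> R -> R) : Prop :=
  vsmooth a b Z /\ (forall t, in_I a b t -> dot Z V t = 0) /\
  forall k t, (k < 4)%nat -> in_I a b t ->
    tangent Z k t = - dot Z (tangent V) t * V k t.

(** Since [V] has unit length, [(Z.V)' = - (Z.V') (V.V) + Z.V' = 0], so orthogonality at [t0]
    propagates. *)
Lemma parallel_exists (a b : Rbar) (V : nat -> R -> R) (c : nat -> R) (t0 : R) :
  vsmooth a b V -> (forall t, in_I a b t -> dot V V t = 1) -> in_I a b t0 ->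
  sum4 (fun k => c k * V k t0) = 0 ->
  exists Z, parallel a b V Z /\ forall k, (k < 4)%nat -> Z k t0 = c k.
Proof.
intros HV H1 H0 Hc.
assert (HA : forall i j, (i < 4)%nat -> (j < 4)%nat ->
  smooth_on a b (fun t => - V i t * tangent V j t)).
{ intros i j Hi Hj; apply smooth_on_mult; [apply smooth_on_opp; auto|].
  now apply vsmooth_tangent. }
destruct (linear_ode a b (fun i j t => - V i t * tangent V j t) c t0)
  as (Z & HZ0 & HZ); auto.
{ intros i j t Hi Hj Ht; apply (smooth_on_continuous a b); auto. }
assert (SZ : vsmooth a b Z) by exact (smooth_on_linear_ode a b _ Z HA HZ).
assert (DZ : forall k t, (k < 4)%nat -> in_I a b t ->
  tangent Z k t = - dot Z (tangent V) t * V k t).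
{ intros k t Hk Ht; unfold tangent at 1.
  rewrite (is_derive_unique _ _ _ (HZ k t Hk Ht)).
  unfold dot, sum4; simpl; ring. }
exists Z; split; [split; [exact SZ | split; [|exact DZ]] | exact HZ0].
intros t Ht; rewrite (constant_on_I a b (dot Z V) t t0); auto.
- rewrite <- Hc; apply sum4_ext; intros k Hk; now rewrite HZ0.
- intros r Hr.
  replace 0 with (dot (tangent Z) V r + dot Z (tangent V) r)
    by (rewrite (dot_scal_l _ _ _ _ _ (fun k Hk => DZ k r Hk Hr)), H1 by exact Hr; ring).
  now apply is_derive_dot with a b.
Qed.

(** [Z'] and [W'] are multiples of [V], to which both fields are orthogonal. *)
Lemma parallel_dot (a b : Rbar) (V Z W : nat -> R -> R) (s t : R) :
  parallel a b V Z -> parallel a b V W -> in_I a b s -> in_I a b t ->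
  dot Z W s = dot Z W t.
Proof.
intros (SZ & OZ & DZ) (SW & OW & DW); apply constant_on_I; intros r Hr.
replace 0 with (dot (tangent Z) W r + dot Z (tangent W) r).
- now apply is_derive_dot with a b.
- rewrite (dot_comm Z (tangent W)).
  rewrite (dot_scal_l _ _ _ _ _ (fun k Hk => DZ k r Hk Hr)).
  rewrite (dot_scal_l _ _ _ _ _ (fun k Hk => DW k r Hk Hr)).
  rewrite (dot_comm V W), (dot_comm V Z), OZ, OW by exact Hr; ring.
Qed.

Lemma parallel_lincomb (a b : Rbar) (V Z1 Z2 Z3 : nat -> R -> R) (c1 c2 c3 : R) :
  parallel a b V Z1 -> parallel a b V Z2 -> parallel a b V Z3 ->
  parallel a b V (fun k t => c1 * Z1 k t + c2 * Z2 k t + c3 * Z3 k t).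
Proof.
intros (S1 & O1 & D1) (S2 & O2 & D2) (S3 & O3 & D3).
assert (Hdot : forall W t, dot (fun k t => c1 * Z1 k t + c2 * Z2 k t + c3 * Z3 k t) W t
  = c1 * dot Z1 W t + c2 * dot Z2 W t + c3 * dot Z3 W t).
{ intros W t; unfold dot, sum4; simpl; ring. }
repeat split.
- intros k Hk; apply smooth_on_plus; [apply smooth_on_plus|]; apply smooth_on_mult;
    auto using smooth_on_const.
- intros t Ht; rewrite Hdot, O1, O2, O3 by exact Ht; ring.
- intros k t Hk Ht; rewrite Hdot.
  assert (E1 := D1 k t Hk Ht); assert (E2 := D2 k t Hk Ht); assert (E3 := D3 k t Hk Ht).
  unfold tangent in *.
  assert (X1 := smooth_on_ex_derive a b _ t (S1 k Hk) Ht).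
  assert (X2 := smooth_on_ex_derive a b _ t (S2 k Hk) Ht).
  assert (X3 := smooth_on_ex_derive a b _ t (S3 k Hk) Ht).
  apply is_derive_unique; auto_derive; [now repeat split|].
  change (fun x => Z1 k x) with (Z1 k); change (fun x => Z2 k x) with (Z2 k).
  change (fun x => Z3 k x) with (Z3 k); rewrite E1, E2, E3; ring.
Qed.

(** * Orthonormal frames and their coefficient matrices *)

Lemma sum4_nonneg_eq0 (f : nat -> R) :
  (forall k, (k < 4)%nat -> 0 <= f k) -> sum4 f = 0 ->
  forall k, (k < 4)%nat -> f k = 0.
Proof.
unfold sum4; simpl; intros H E.
assert (H0 := H 0%nat ltac:(lia)); assert (H1 := H 1%nat ltac:(lia)).
assert (H2 := H 2%nat ltac:(lia)); assert (H3 := H 3%nat ltac:(lia)).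
apply forall_lt4; lra.
Qed.

Definition delta (i j : nat) : R := if Nat.eqb i j then 1 else 0.

(* Both [Z^T Z - 1] and [Z Z^T - 1] have the same Frobenius norm. *)
Lemma orthonormal_columns (Z : nat -> nat -> R) :
  (forall i j, (i < 4)%nat -> (j < 4)%nat -> sum4 (fun k => Z i k * Z j k) = delta i j) ->
  forall i j, (i < 4)%nat -> (j < 4)%nat -> sum4 (fun k => Z k i * Z k j) = delta i j.
Proof.
intros H.
assert (E : sum4 (fun i => sum4 (fun j => (sum4 (fun k => Z k i * Z k j) - delta i j) ^ 2)) = 0).
{ transitivity
    (sum4 (fun i => sum4 (fun j => (sum4 (fun k => Z i k * Z j k) - delta i j) ^ 2))).
  - unfold sum4, delta; simpl; ring.
  - transitivity (sum4 (fun _ => sum4 (fun _ => 0))).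
    + apply sum4_ext; intros i Hi; apply sum4_ext; intros j Hj; rewrite H by auto; ring.
    + unfold sum4; simpl; ring. }
intros i j Hi Hj; apply Rminus_diag_uniq, Rsqr_0_uniq; rewrite Rsqr_pow2.
apply (sum4_nonneg_eq0 (fun j => (sum4 (fun k => Z k i * Z k j) - delta i j) ^ 2));
  [intros; apply pow2_ge_0 | | exact Hj].
apply (sum4_nonneg_eq0
  (fun i => sum4 (fun j => (sum4 (fun k => Z k i * Z k j) - delta i j) ^ 2)));
  [| exact E | exact Hi].
intros k _; unfold sum4; simpl sum_f_R0.
repeat apply Rplus_le_le_0_compat; apply pow2_ge_0.
Qed.

Lemma parseval (Z : nat -> nat -> R -> R) (U : nat -> R -> R) (t : R) :
  (forall i j, (i < 4)%nat -> (j < 4)%nat -> dot (Z i) (Z j) t = delta i j) ->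
  dot U U t = sum4 (fun i => dot U (Z i) t ^ 2).
Proof.
intros H; assert (C := orthonormal_columns (fun i j => Z i j t) H); simpl in C.
transitivity (sum4 (fun k => sum4 (fun l =>
  U k t * U l t * sum4 (fun i => Z i k t * Z i l t)))).
- transitivity (sum4 (fun k => sum4 (fun l => U k t * U l t * delta k l))).
  + unfold dot, sum4, delta; simpl; ring.
  + apply sum4_ext; intros k Hk; apply sum4_ext; intros l Hl; now rewrite C.
- unfold dot, sum4; simpl; ring.
Qed.

(** [Z' = (Z' Z^T) Z], because orthonormal rows force orthonormal columns. *)
Lemma frame_coef_matrix (a b : Rbar) (gamma : nat -> R -> R)
    (Z : nat -> nat -> R -> R) :
  frame_on a b gamma Z ->
  is_coef_matrix a b Z (fun i j t => dot (tangent (Z i)) (Z j) t).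
Proof.
intros (_ & _ & HO) i j t Hi Hj Ht.
assert (C := orthonormal_columns (fun i j => Z i j t)
  (fun i j Hi Hj => HO i j t Hi Hj Ht)); simpl in C.
transitivity (sum4 (fun l => tangent (Z i) l t * sum4 (fun k => Z k l t * Z k j t))).
- transitivity (sum4 (fun l => tangent (Z i) l t * delta l j)).
  + revert j Hj; unfold sum4, delta, tangent; apply forall_lt4; simpl; ring.
  + apply sum4_ext; intros l Hl; now rewrite C.
- unfold dot, sum4; simpl; ring.
Qed.

Lemma frame_coef_skew (a b : Rbar) (gamma : nat -> R -> R)
    (Z : nat -> nat -> R -> R) (i j : nat) (t : R) :
  frame_on a b gamma Z -> (i < 4)%nat -> (j < 4)%nat -> in_I a b t ->
  dot (tangent (Z i)) (Z j) t = - dot (tangent (Z j)) (Z i) t.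
Proof.
intros (HS & _ & HO) Hi Hj Ht; rewrite (dot_comm (tangent (Z j))).
apply dot_const_deriv with a b (delta i j); auto.
- intros k Hk; now apply HS.
- intros k Hk; now apply HS.
- intros s Hs; now apply HO.
Qed.

Lemma frame_of_type_intro
    (M : (R -> R) -> (R -> R) -> (R -> R) -> nat -> nat -> R -> R)
    (a b : Rbar) (gamma : nat -> R -> R) (Z : nat -> nat -> R -> R) (x1 x2 x3 : R -> R) :
  frame_on a b gamma Z ->
  smooth_on a b x1 -> smooth_on a b x2 -> smooth_on a b x3 ->
  (forall i j t, (i < 4)%nat -> (j < 4)%nat -> in_I a b t ->
     dot (tangent (Z i)) (Z j) t = M x1 x2 x3 i j t) ->
  frame_of_type M a b gamma Z.
Proof.
intros HZ S1 S2 S3 HM; split; [exact HZ|].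
exists (fun i => i), x1, x2, x3; repeat split; auto.
intros i j t Hi Hj Ht; unfold permute_frame.
etransitivity; [exact (frame_coef_matrix a b gamma Z HZ i j t Hi Hj Ht)|].
apply sum4_ext; intros k Hk; now rewrite HM.
Qed.

(** Skewness leaves six entries, three of which must vanish. Two of them are stated through the
    derivative of [Z 2], which the construction makes a multiple of the tangent. *)
Lemma frame_type_C_intro (a b : Rbar) (gamma : nat -> R -> R)
    (Z : nat -> nat -> R -> R) :
  frame_on a b gamma Z ->
  (forall t, in_I a b t ->
     dot (tangent (Z 0%nat)) (Z 3%nat) t = 0 /\
     dot (tangent (Z 2%nat)) (Z 1%nat) t = 0 /\
     dot (tangent (Z 2%nat)) (Z 3%nat) t = 0) ->
  frame_type_C a b gamma Z.
Proof.
intros HZ H0; assert (HS := HZ); destruct HS as (HS & _ & _).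
assert (HX : forall i j, (i < 4)%nat -> (j < 4)%nat ->
  smooth_on a b (dot (tangent (Z i)) (Z j))).
{ intros i j Hi Hj; apply smooth_on_dot; [apply vsmooth_tangent|]; intros k Hk; auto. }
apply frame_of_type_intro with (dot (tangent (Z 0%nat)) (Z 1%nat))
  (dot (tangent (Z 0%nat)) (Z 2%nat)) (dot (tangent (Z 1%nat)) (Z 3%nat)); auto with arith.
intros i j t Hi Hj Ht.
assert (Sk := fun i j Hi Hj => frame_coef_skew a b gamma Z i j t HZ Hi Hj Ht).
destruct (H0 t Ht) as (E03 & E21 & E23).
assert (K0 := Sk 0%nat 0%nat ltac:(lia) ltac:(lia)).
assert (K1 := Sk 1%nat 1%nat ltac:(lia) ltac:(lia)).
assert (K2 := Sk 2%nat 2%nat ltac:(lia) ltac:(lia)).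
assert (K3 := Sk 3%nat 3%nat ltac:(lia) ltac:(lia)).
assert (K10 := Sk 1%nat 0%nat ltac:(lia) ltac:(lia)).
assert (K20 := Sk 2%nat 0%nat ltac:(lia) ltac:(lia)).
assert (K30 := Sk 3%nat 0%nat ltac:(lia) ltac:(lia)).
assert (K12 := Sk 1%nat 2%nat ltac:(lia) ltac:(lia)).
assert (K31 := Sk 3%nat 1%nat ltac:(lia) ltac:(lia)).
assert (K32 := Sk 3%nat 2%nat ltac:(lia) ltac:(lia)).
destruct i as [|[|[|[|i]]]]; try lia; destruct j as [|[|[|[|j]]]]; try lia; simpl; lra.
Qed.

(** Together with skewness, the three zeros say that the derivatives of [Z 0], [Z 2] and [Z 3] are
    all multiples of [Z 1]. *)
Lemma frame_type_D_intro (a b : Rbar) (gamma : nat -> R -> R)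
    (Z : nat -> nat -> R -> R) :
  frame_on a b gamma Z ->
  (forall t, in_I a b t ->
     dot (tangent (Z 0%nat)) (Z 2%nat) t = 0 /\
     dot (tangent (Z 0%nat)) (Z 3%nat) t = 0 /\
     dot (tangent (Z 2%nat)) (Z 3%nat) t = 0) ->
  frame_type_D a b gamma Z.
Proof.
intros HZ H0; assert (HS := HZ); destruct HS as (HS & _ & _).
assert (HX : forall i j, (i < 4)%nat -> (j < 4)%nat ->
  smooth_on a b (dot (tangent (Z i)) (Z j))).
{ intros i j Hi Hj; apply smooth_on_dot; [apply vsmooth_tangent|]; intros k Hk; auto. }
apply frame_of_type_intro with (dot (tangent (Z 0%nat)) (Z 1%nat))
  (dot (tangent (Z 1%nat)) (Z 2%nat)) (dot (tangent (Z 1%nat)) (Z 3%nat)); auto with arith.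
intros i j t Hi Hj Ht.
assert (Sk := fun i j Hi Hj => frame_coef_skew a b gamma Z i j t HZ Hi Hj Ht).
destruct (H0 t Ht) as (E02 & E03 & E23).
assert (K0 := Sk 0%nat 0%nat ltac:(lia) ltac:(lia)).
assert (K1 := Sk 1%nat 1%nat ltac:(lia) ltac:(lia)).
assert (K2 := Sk 2%nat 2%nat ltac:(lia) ltac:(lia)).
assert (K3 := Sk 3%nat 3%nat ltac:(lia) ltac:(lia)).
assert (K10 := Sk 1%nat 0%nat ltac:(lia) ltac:(lia)).
assert (K20 := Sk 2%nat 0%nat ltac:(lia) ltac:(lia)).
assert (K30 := Sk 3%nat 0%nat ltac:(lia) ltac:(lia)).
assert (K21 := Sk 2%nat 1%nat ltac:(lia) ltac:(lia)).
assert (K31 := Sk 3%nat 1%nat ltac:(lia) ltac:(lia)).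
assert (K32 := Sk 3%nat 2%nat ltac:(lia) ltac:(lia)).
destruct i as [|[|[|[|i]]]]; try lia; destruct j as [|[|[|[|j]]]]; try lia; simpl; lra.
Qed.

(** * The ternary cross product and completion of frames *)

Definition det3 (x y z : nat -> R) (i j k : nat) : R :=
  x i * (y j * z k - y k * z j) - x j * (y i * z k - y k * z i)
  + x k * (y i * z j - y j * z i).

(** The cofactors along the first row of a 4 by 4 determinant whose remaining rows are [U], [V],
    [W]. *)
Definition cross (U V W : nat -> R -> R) (k : nat) (t : R) : R :=
  let d := det3 (fun k => U k t) (fun k => V k t) (fun k => W k t) in
  match k with
  | 0 => d 1%nat 2%nat 3%nat
  | 1 => - d 0%nat 2%nat 3%nat
  | 2 => d 0%nat 1%nat 3%nat
  | _ => - d 0%nat 1%nat 2%nat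
  end%nat.

Lemma dot_cross (U V W : nat -> R -> R) (t : R) :
  dot (cross U V W) U t = 0 /\ dot (cross U V W) V t = 0 /\ dot (cross U V W) W t = 0.
Proof.
unfold dot, sum4, cross, det3; simpl; repeat split; ring.
Qed.

(* The right-hand side is the Gram determinant of [U, V, W]. *)
Lemma dot_cross_cross (U V W : nat -> R -> R) (t : R) :
  dot (cross U V W) (cross U V W) t =
    dot U U t * (dot V V t * dot W W t - dot V W t ^ 2)
    - dot U V t * (dot U V t * dot W W t - dot V W t * dot U W t)
    + dot U W t * (dot U V t * dot V W t - dot V V t * dot U W t).
Proof.
unfold dot, sum4, cross, det3; simpl; ring.
Qed.

Lemma vsmooth_cross (a b : Rbar) (U V W : nat -> R -> R) :
  vsmooth a b U -> vsmooth a b V -> vsmooth a b W -> vsmooth a b (cross U V W).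
Proof.
intros HU HV HW.
assert (HD : forall i j k, (i < 4)%nat -> (j < 4)%nat -> (k < 4)%nat ->
  smooth_on a b (fun t => det3 (fun k => U k t) (fun k => V k t) (fun k => W k t) i j k)).
{ assert (H2 : forall j k, (j < 4)%nat -> (k < 4)%nat ->
    smooth_on a b (fun t => V j t * W k t - V k t * W j t)).
  { intros j k Hj Hk; apply smooth_on_minus; apply smooth_on_mult; auto. }
  intros i j k Hi Hj Hk; unfold det3.
  apply smooth_on_plus; [apply smooth_on_minus|]; apply smooth_on_mult; auto. }
intros k Hk; destruct k as [|[|[|[|k]]]]; [| | | |lia].
- exact (HD 1%nat 2%nat 3%nat ltac:(lia) ltac:(lia) ltac:(lia)).
- exact (smooth_on_opp a b _ (HD 0%nat 2%nat 3%nat ltac:(lia) ltac:(lia) ltac:(lia))).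
- exact (HD 0%nat 1%nat 3%nat ltac:(lia) ltac:(lia) ltac:(lia)).
- exact (smooth_on_opp a b _ (HD 0%nat 1%nat 2%nat ltac:(lia) ltac:(lia) ltac:(lia))).
Qed.

Definition normalize (U : nat -> R -> R) (k : nat) (t : R) : R :=
  / sqrt (dot U U t) * U k t.

Lemma dot_normalize_l (U V : nat -> R -> R) (t : R) :
  dot (normalize U) V t = / sqrt (dot U U t) * dot U V t.
Proof. now apply dot_scal_l. Qed.

Lemma dot_normalize (U : nat -> R -> R) (t : R) :
  0 < dot U U t -> dot (normalize U) (normalize U) t = 1.
Proof.
intros H; rewrite dot_normalize_l, (dot_comm U (normalize U)), dot_normalize_l.
rewrite <- (sqrt_sqrt (dot U U t)) at 3 by lra.
assert (H1 := sqrt_lt_R0 _ H); field; lra.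
Qed.

Lemma vsmooth_normalize (a b : Rbar) (U : nat -> R -> R) :
  vsmooth a b U -> (forall t, in_I a b t -> 0 < dot U U t) ->
  vsmooth a b (normalize U).
Proof.
intros HU H k Hk; apply smooth_on_mult; [|now apply HU].
apply (smooth_on_inv_sqrt a b (dot U U)); [exact H | now apply smooth_on_dot].
Qed.

(** The cross product of [U], [V] and the basis vector [e_i] has squared length [1 - U_i^2 - V_i^2].
    Over the four indices these numbers add up to 2, so one of them is positive. *)
Lemma unit_normal_exists (U V : nat -> R -> R) (t : R) :
  dot U U t = 1 -> dot V V t = 1 -> dot U V t = 0 ->
  exists c : nat -> R, sum4 (fun k => c k * c k) = 1 /\
    sum4 (fun k => c k * U k t) = 0 /\ sum4 (fun k => c k * V k t) = 0.
Proof.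
intros HU HV HUV.
assert (Hi : forall i, (i < 4)%nat -> 0 < 1 - U i t ^ 2 - V i t ^ 2 ->
  exists c : nat -> R, sum4 (fun k => c k * c k) = 1 /\
    sum4 (fun k => c k * U k t) = 0 /\ sum4 (fun k => c k * V k t) = 0).
{ intros i Hi Hpos; set (e := fun k (_ : R) => delta i k).
  assert (He : dot e e t = 1 /\ dot U e t = U i t /\ dot V e t = V i t).
  { destruct i as [|[|[|[|i]]]]; try lia; unfold dot, sum4, e, delta; simpl; repeat split; ring. }
  destruct He as (E1 & E2 & E3).
  destruct (dot_cross U V e t) as (C1 & C2 & _).
  assert (HC := dot_cross_cross U V e t).
  rewrite E1, E2, E3, HU, HV, HUV in HC.
  exists (fun k => normalize (cross U V e) k t); repeat split.
  - apply (dot_normalize (cross U V e)); lra.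
  - transitivity (dot (normalize (cross U V e)) U t); [reflexivity|].
    rewrite dot_normalize_l, C1; ring.
  - transitivity (dot (normalize (cross U V e)) V t); [reflexivity|].
    rewrite dot_normalize_l, C2; ring. }
apply NNPP; intros Hno.
assert (Hle : forall i, (i < 4)%nat -> 1 - U i t ^ 2 - V i t ^ 2 <= 0).
{ intros i L; apply Rnot_lt_le; intros H; exact (Hno (Hi i L H)). }
unfold dot, sum4 in HU, HV; simpl in HU, HV.
assert (L0 := Hle 0%nat ltac:(lia)); assert (L1 := Hle 1%nat ltac:(lia)).
assert (L2 := Hle 2%nat ltac:(lia)); assert (L3 := Hle 3%nat ltac:(lia)).
lra.
Qed.

Definition frame4 (A B C D : nat -> R -> R) (i : nat) : nat -> R -> R :=
  match i with 0 => A | 1 => B | 2 => C | _ => D end%nat.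

Lemma frame4_orthonormal (A B C D : nat -> R -> R) (t : R) :
  dot A A t = 1 -> dot B B t = 1 -> dot C C t = 1 -> dot D D t = 1 ->
  dot A B t = 0 -> dot A C t = 0 -> dot A D t = 0 ->
  dot B C t = 0 -> dot B D t = 0 -> dot C D t = 0 ->
  forall i j, (i < 4)%nat -> (j < 4)%nat ->
    dot (frame4 A B C D i) (frame4 A B C D j) t = delta i j.
Proof.
intros AA BB CC DD AB AC AD BC BD CD i j Hi Hj.
destruct i as [|[|[|[|i]]]]; try lia; destruct j as [|[|[|[|j]]]]; try lia; unfold delta; simpl; auto;
  now rewrite dot_comm.
Qed.

Lemma frame4_frame_on (a b : Rbar) (gamma B C D : nat -> R -> R) :
  vsmooth a b (tangent gamma) -> vsmooth a b B -> vsmooth a b C -> vsmooth a b D ->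
  (forall i j t, (i < 4)%nat -> (j < 4)%nat -> in_I a b t ->
    dot (frame4 (tangent gamma) B C D i) (frame4 (tangent gamma) B C D j) t = delta i j) ->
  frame_on a b gamma (frame4 (tangent gamma) B C D).
Proof.
intros HA HB HC HD HO; repeat split; auto.
intros i j Hi; destruct i as [|[|[|[|i]]]]; [apply HA | apply HB | apply HC | apply HD | lia].
Qed.

(** * Construction of the two frames *)

Lemma arclength_tangent (a b : Rbar) (gamma : nat -> R -> R) :
  arclength_curve a b gamma ->
  vsmooth a b (tangent gamma) /\
  (forall t, in_I a b t -> dot (tangent gamma) (tangent gamma) t = 1) /\
  (forall t, in_I a b t -> dot (tangent (tangent gamma)) (tangent gamma) t = 0).
Proof.
intros [HS H1].
assert (ST : vsmooth a b (tangent gamma)) by now apply vsmooth_tangent.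
assert (HT : forall t, in_I a b t -> dot (tangent gamma) (tangent gamma) t = 1).
{ intros t Ht; rewrite <- (H1 t Ht); apply sum4_ext; intros; ring. }
repeat split; auto.
intros t Ht; assert (E := dot_const_deriv a b _ _ 1 t ST ST HT Ht).
rewrite (dot_comm (tangent gamma)) in E; lra.
Qed.

Lemma two_regular_curvature_pos (a b : Rbar) (gamma : nat -> R -> R) (t : R) :
  two_regular a b gamma -> in_I a b t ->
  0 < dot (tangent (tangent gamma)) (tangent (tangent gamma)) t.
Proof.
intros H Ht; destruct (H t Ht) as (k & Hk & Hd); set (K := tangent (tangent gamma)).
assert (H0 : forall k, 0 <= K k t * K k t).
{ intros j; apply Rle_0_sqr. }
assert (H1 : 0 <= dot K K t).
{ unfold dot, sum4; simpl; repeat apply Rplus_le_le_0_compat; apply H0. }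
destruct H1 as [H1|H1]; [exact H1|].
exfalso; apply Hd, Rsqr_0_uniq.
exact (sum4_nonneg_eq0 (fun k => K k t * K k t) (fun j _ => H0 j) (eq_sym H1) k Hk).
Qed.

Lemma type_D_exists (a b : Rbar) (gamma : nat -> R -> R) (t0 : R) :
  arclength_curve a b gamma -> two_regular a b gamma -> in_I a b t0 ->
  exists Z, frame_type_D a b gamma Z.
Proof.
intros Harc Hreg H0.
destruct (arclength_tangent a b gamma Harc) as (ST & TT & KT).
assert (Q := fun t => two_regular_curvature_pos a b gamma t Hreg).
set (T := tangent gamma) in *; set (K := tangent T) in *.
assert (SK : vsmooth a b K) by now apply vsmooth_tangent.
set (N := normalize K).
assert (SN : vsmooth a b N) by now apply vsmooth_normalize.
assert (NN : forall t, in_I a b t -> dot N N t = 1).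
{ intros t Ht; apply dot_normalize; auto. }
assert (TN : forall t, in_I a b t -> dot T N t = 0).
{ intros t Ht; rewrite dot_comm; unfold N; rewrite dot_normalize_l, KT by exact Ht.
  apply Rmult_0_r. }
assert (Q1 : forall t, in_I a b t -> 0 < sqrt (dot K K t)).
{ intros t Ht; apply sqrt_lt_R0; auto. }
assert (KN : forall k t, in_I a b t -> K k t = sqrt (dot K K t) * N k t).
{ intros k t Ht; unfold N, normalize; assert (H := Q1 t Ht); field; lra. }
(* [T'] is [(T'.N) N], and differentiating [T.N = 0] turns [T'.N] into [- T.N']. *)
assert (PT : parallel a b N T).
{ split; [exact ST | split; [exact TN|]]; intros k t Hk Ht.
  rewrite <- (dot_const_deriv a b T N 0 t ST SN TN Ht); change (tangent T) with K.
  rewrite (dot_scal_l K N N _ t (fun k _ => KN k t Ht)), NN by exact Ht.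
  rewrite Rmult_1_r; now apply KN. }
destruct (unit_normal_exists T N t0) as (c & Hcc & HcT & HcN); auto.
destruct (parallel_exists a b N c t0) as (Z2 & PZ & HZc); auto.
assert (ZZ : forall t, in_I a b t -> dot Z2 Z2 t = 1).
{ intros t Ht; rewrite (parallel_dot a b N Z2 Z2 t t0) by auto.
  rewrite <- Hcc; apply sum4_ext; intros k Hk; now rewrite HZc. }
assert (ZT : forall t, in_I a b t -> dot T Z2 t = 0).
{ intros t Ht; rewrite dot_comm, (parallel_dot a b N Z2 T t t0) by auto.
  rewrite <- HcT; apply sum4_ext; intros k Hk; now rewrite HZc. }
destruct PZ as (SZ & ZN & DZ).
set (Z3 := cross T N Z2).
assert (S3 : vsmooth a b Z3) by now apply vsmooth_cross.
assert (O3 := dot_cross T N Z2); fold Z3 in O3.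
exists (frame4 T N Z2 Z3); apply frame_type_D_intro.
- apply frame4_frame_on; auto.
  intros i j t Hi Hj Ht; destruct (O3 t) as (O3T & O3N & O3Z).
  apply frame4_orthonormal; auto; try (rewrite dot_comm; now auto).
  (* The Gram determinant of an orthonormal triple is 1, so [Z3] is already a unit field. *)
  unfold Z3; rewrite dot_cross_cross, TT, NN, ZZ, TN, ZT, (dot_comm N), ZN by exact Ht.
  ring.
- intros t Ht; destruct (O3 t) as (O3T & O3N & O3Z); simpl.
  change (tangent T) with K.
  rewrite (dot_scal_l K N Z2 _ t (fun k _ => KN k t Ht)).
  rewrite (dot_scal_l K N Z3 _ t (fun k _ => KN k t Ht)).
  rewrite (dot_scal_l _ _ _ _ _ (fun k Hk => DZ k t Hk Ht)).
  rewrite !(dot_comm N), ZN, O3N by exact Ht; repeat split; ring.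
Qed.

Lemma type_C_exists (a b : Rbar) (gamma : nat -> R -> R) (t0 : R) :
  arclength_curve a b gamma -> two_regular a b gamma -> in_I a b t0 ->
  exists Z, frame_type_C a b gamma Z.
Proof.
intros Harc Hreg H0.
destruct (arclength_tangent a b gamma Harc) as (ST & TT & KT).
assert (Q := fun t => two_regular_curvature_pos a b gamma t Hreg).
set (T := tangent gamma) in *; set (K := tangent T) in *.
assert (SK : vsmooth a b K) by now apply vsmooth_tangent.
assert (HP : exists P1 P2 P3 : nat -> R -> R,
  parallel a b T P1 /\ parallel a b T P2 /\ parallel a b T P3 /\
  forall t, in_I a b t ->
    (dot P1 P1 t = 1 /\ dot P2 P2 t = 1 /\ dot P3 P3 t = 1) /\
    (dot P1 P2 t = 0 /\ dot P1 P3 t = 0 /\ dot P2 P3 t = 0)).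
{ assert (T0 := TT t0 H0); unfold dot, sum4 in T0; simpl in T0.
  (* At [t0] the initial vectors are the quaternion products of [i], [j], [k] with [T]. *)
  destruct (parallel_exists a b T (fun k => match k with
    0 => - T 1%nat t0 | 1 => T 0%nat t0 | 2 => - T 3%nat t0 | _ => T 2%nat t0 end%nat) t0)
    as (P1 & PP1 & I1); auto; [unfold sum4; simpl; ring|].
  destruct (parallel_exists a b T (fun k => match k with
    0 => - T 2%nat t0 | 1 => T 3%nat t0 | 2 => T 0%nat t0 | _ => - T 1%nat t0 end%nat) t0)
    as (P2 & PP2 & I2); auto; [unfold sum4; simpl; ring|].
  destruct (parallel_exists a b T (fun k => match k with
    0 => - T 3%nat t0 | 1 => - T 2%nat t0 | 2 => T 1%nat t0 | _ => T 0%nat t0 end%nat) t0)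
    as (P3 & PP3 & I3); auto; [unfold sum4; simpl; ring|].
  exists P1, P2, P3; do 3 (split; [assumption|]); intros t Ht.
  rewrite !(fun U V HU HV => parallel_dot a b T U V t t0 HU HV Ht H0) by assumption.
  unfold dot, sum4; simpl; rewrite !I1, !I2, !I3 by lia.
  repeat split; first [ring | rewrite <- T0; ring]. }
destruct HP as (P1 & P2 & P3 & PP1 & PP2 & PP3 & HP).
(* [T'] has no component along [T], so 2-regularity means that its coordinates in [(P1, P2, P3)]
   never vanish together. *)
assert (Hq : forall t, in_I a b t ->
  dot K K t = dot K P1 t ^ 2 + dot K P2 t ^ 2 + dot K P3 t ^ 2).
{ intros t Ht; destruct (HP t Ht) as ((D1 & D2 & D3) & D12 & D13 & D23).
  rewrite (parseval (frame4 T P1 P2 P3)).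
  - unfold sum4; simpl sum_f_R0; simpl frame4; rewrite KT by exact Ht; ring.
  - apply frame4_orthonormal; auto; rewrite dot_comm;
      [now apply PP1 | now apply PP2 | now apply PP3]. }
destruct (smooth_curve_misses_direction a b (dot K P1) (dot K P2) (dot K P3))
  as (x & y & Hxy).
1-3: apply smooth_on_dot; [exact SK|].
1: apply PP1. 1: apply PP2. 1: apply PP3.
{ intros t Ht; rewrite <- Hq; auto. }
(* Scales the coefficient vector [(x, y, 1)] to unit length. *)
set (mu := / sqrt (1 + x ^ 2 + y ^ 2)).
assert (Hs : 0 < 1 + x ^ 2 + y ^ 2) by nra.
assert (Hmu : mu ^ 2 * (1 + x ^ 2 + y ^ 2) = 1).
{ unfold mu; rewrite <- (sqrt_sqrt (1 + x ^ 2 + y ^ 2)) at 2 by lra.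
  assert (H1 := sqrt_lt_R0 _ Hs); field; lra. }
set (Z2 := fun k t => mu * x * P1 k t + mu * y * P2 k t + mu * P3 k t).
assert (PZ : parallel a b T Z2) by now apply parallel_lincomb.
assert (Hdot : forall W t, dot W Z2 t
  = mu * (x * dot W P1 t + y * dot W P2 t + dot W P3 t)).
{ intros W t; unfold Z2, dot, sum4; simpl; ring. }
destruct PZ as (S2 & ZT & DZ).
assert (ZZ : forall t, in_I a b t -> dot Z2 Z2 t = 1).
{ intros t Ht; destruct (HP t Ht) as ((D1 & D2 & D3) & D12 & D13 & D23).
  rewrite Hdot, !(dot_comm Z2), !Hdot, (dot_comm P2 P1), (dot_comm P3 P1),
    (dot_comm P3 P2), D1, D2, D3, D12, D13, D23.
  transitivity (mu ^ 2 * (1 + x ^ 2 + y ^ 2)); [ring | exact Hmu]. }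
set (C := cross T K Z2).
assert (OC := dot_cross T K Z2); fold C in OC.
(* Lagrange's identity: the Gram determinant vanishes only if [K] is proportional to [Z2]. *)
assert (CC : forall t, in_I a b t -> 0 < dot C C t).
{ intros t Ht; unfold C.
  rewrite dot_cross_cross, TT, ZZ, (dot_comm T K), KT, (dot_comm T Z2), ZT by exact Ht.
  rewrite Hdot, Hq by exact Ht.
  assert (Hn := Hxy t Ht); assert (Hpos := Q t Ht); rewrite Hq in Hpos by exact Ht.
  set (n1 := dot K P1 t) in *; set (n2 := dot K P2 t) in *; set (n3 := dot K P3 t) in *.
  (* The three squares are those of the components, up to sign, of the cross product of
     [(n1, n2, n3)] and [(x, y, 1)]. The last term, zero by [Hmu], makes the equality a polynomial
     identity in [mu]. *)
  replace (_ + _) with (mu ^ 2 * ((n1 - x * n3) ^ 2 + (n2 - y * n3) ^ 2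
    + (x * n2 - y * n1) ^ 2) + (1 - mu ^ 2 * (1 + x ^ 2 + y ^ 2)) * (n1 ^ 2 + n2 ^ 2 + n3 ^ 2))
    by ring.
  rewrite Hmu, Rminus_diag, Rmult_0_l, Rplus_0_r.
  apply Rmult_lt_0_compat; [nra|].
  assert (L1 := pow2_ge_0 (n1 - x * n3)); assert (L2 := pow2_ge_0 (n2 - y * n3)).
  assert (L3 := pow2_ge_0 (x * n2 - y * n1)).
  destruct (Req_dec (n1 - x * n3) 0) as [E1|E1];
    [destruct (Req_dec (n2 - y * n3) 0) as [E2|E2]|].
  - exfalso; apply Hn; lra.
  - assert (0 < (n2 - y * n3) ^ 2) by now apply pow2_gt_0.
    lra.
  - assert (0 < (n1 - x * n3) ^ 2) by now apply pow2_gt_0.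
    lra. }
set (Z3 := normalize C).
assert (S3 : vsmooth a b Z3) by (apply vsmooth_normalize; auto; now apply vsmooth_cross).
assert (O3 : forall t, dot Z3 T t = 0 /\ dot Z3 K t = 0 /\ dot Z3 Z2 t = 0).
{ intros t; unfold Z3; rewrite !dot_normalize_l; destruct (OC t) as (-> & -> & ->).
  repeat split; ring. }
assert (Z33 : forall t, in_I a b t -> dot Z3 Z3 t = 1).
{ intros t Ht; apply dot_normalize; auto. }
set (Z1 := cross T Z2 Z3).
assert (S1 : vsmooth a b Z1) by now apply vsmooth_cross.
assert (O1 := dot_cross T Z2 Z3); fold Z1 in O1.
exists (frame4 T Z1 Z2 Z3); apply frame_type_C_intro.
- apply frame4_frame_on; auto.
  intros i j t Hi Hj Ht.
  destruct (O3 t) as (O3T & O3K & O3Z); destruct (O1 t) as (O1T & O12 & O13).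
  apply frame4_orthonormal; auto; try (rewrite dot_comm; now auto).
  unfold Z1; rewrite dot_cross_cross, TT, ZZ, Z33, (dot_comm T Z2), ZT, (dot_comm T Z3),
    (dot_comm Z2 Z3), O3T, O3Z by exact Ht.
  ring.
(* [Z2'] is along [T], hence orthogonal to [Z1] and [Z3]; the remaining zero is the orthogonality of
   [Z3] and [K]. *)
- intros t Ht.
  destruct (O3 t) as (O3T & O3K & O3Z); destruct (O1 t) as (O1T & O12 & O13); simpl.
  rewrite !(fun W => dot_scal_l _ _ W _ _ (fun k Hk => DZ k t Hk Ht)).
  rewrite !(dot_comm T), O1T, O3T; change (tangent T) with K.
  rewrite (dot_comm K), O3K; repeat split; ring.
Qed.

Theorem theorem2 (a b : Rbar) (gamma : nat -> R -> R) :
  arclength_curve a b gamma ->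
  two_regular a b gamma ->
  (exists Z, frame_type_C a b gamma Z) /\ (exists Z, frame_type_D a b gamma Z).
Proof.
intros Harc Hreg.
destruct (classic (exists t0, in_I a b t0)) as [[t0 H0]|Hempty].
- split; [now apply type_C_exists with t0 | now apply type_D_exists with t0].
(* On an empty interval every pointwise condition is vacuous, and the zero family serves for both
   types. *)
- assert (H : forall t, ~ in_I a b t) by (intros t Ht; apply Hempty; now exists t).
  assert (HM : forall M, frame_of_type M a b gamma (fun _ _ _ => 0)).
  { intros M; apply frame_of_type_intro with (fun _ => 0) (fun _ => 0) (fun _ => 0);
      auto using smooth_on_const.
    2: intros i j t _ _ Ht; destruct (H t Ht).
    split; [intros; apply smooth_on_const|].
    split; intros; exfalso; eapply H; eassumption. }
  split; eexists; apply HM.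
Qed.
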